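(* Let $t>0$. Assume that $C$ and $D$ are generators of the $lC_0$-semigroups $\exp(sC)$ and $\exp(sD)$ in a sequentially complete (Hausdorff) locally convex space $\mathbf{X}$, and that: (i) $\mathcal{D}(C)\cap\mathcal{D}(D)$ is dense in $\mathbf{X}$; (ii) the function $[0,\infty)\ni s\mapsto\exp(sC)\exp(sD)$ belongs to $\mathcal{E}_{\mathbf{X}}$. Let $l>0$ and $h\in\mathcal{D}(\overline{C+D})$. Then the local solution $f:[0,l)\to\mathbf{X}$ of the system $$f'(v)=(\overline{C+D})f(v),\qquad f(0)=h,$$ exists on the semi-interval $[0,l)$ if and only if the following conditions are satisfied: (a) for any $s\in[0,l/t)$, every subsequence of the sequence $\{(\exp(\tfrac tnC)\exp(\tfrac tnD))^{[ns]}h\}_{n\in\mathbb{N}}$ has a convergent subsequence; (b) for any $s\in[0,l/t)$ there exists a sequence $\{f_n^s\}_{n=1}^\infty$, $f_n^s\in\mathcal{D}(\overline{C+D})$, such that $w\text{-}\lim_{n\to\infty}\left((\exp(\tfrac tnC)\exp(\tfrac tnD))^{[ns]}h-f_n^s\right)=0$ and every subsequence of the sequence $\{(\overline{C+D})f_n^s\}_{n=1}^\infty$ has a weakly convergent subsequence. Moreover, if conditions (a)–(b) are satisfied, then $$f(s)=\lim_{n\to\infty}\left(\exp(\tfrac snC)\exp(\tfrac snD)\right)^nh,\quad s\in[0,l).$$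
   Context: $\mathbf{X}$ is over $\mathbb{T}\in\{\mathbb{R},\mathbb{C}\}$ with topology generated by semi-norms $\|\cdot\|_\alpha$, $\alpha\in\Omega$. $\mathcal{L}(\mathbf{X})$ is the space of bounded linear operators in $\mathbf{X}$ with the topology of pointwise convergence; $I$ is the identity; $\mathcal{D}(\cdot)$ denotes domain; $[\cdot]$ is the integer part; $w\text{-}\lim$ is the limit in the weak topology $\sigma(\mathbf{X},\mathbf{X}^* )$. A family $G_\beta\in\mathcal{L}(\mathbf{X})$, $\beta\in\Gamma$, is equicontinuous if for any $\alpha\in\Omega$ there are finitely many $\alpha_1,\dots,\alpha_n\in\Omega$ and $b_1,\dots,b_n>0$ with $\sup_\beta\|G_\beta x\|_\alpha\le\sum_i b_i\|x\|_{\alpha_i}$ for all $x\in\mathbf{X}$. For $F:[0,\infty)\to\mathcal{L}(\mathbf{X})$ and $s\ge0$ put $\mathbf{B}^F_s=\{F(\tfrac dn)^m : md/n\le s,\ n,m\in\mathbb{N},\ d\ge0\}$. $\mathcal{E}_{\mathbf{X}}$ is the set of $F:[0,\infty)\to\mathcal{L}(\mathbf{X})$ with $F(0)=I$ and $\mathbf{B}^F_s$ equicontinuous for every $s\ge0$. An $lC_0$-semigroup is a continuous function $T:[0,\infty)\to\mathcal{L}(\mathbf{X})$ with $T(0)=I$, $T(l+m)=T(l)T(m)$ for $l,m\ge0$, and $T\in\mathcal{E}_{\mathbf{X}}$. Its generator is the operator $Z\psi=\lim_{h\to0}h^{-1}(T(h)\psi-\psi)$ with domain the set of all $\psi$ for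 which the limit exists; one writes $T(t)=\exp(tZ)$. $C+D$ has domain $\mathcal{D}(C)\cap\mathcal{D}(D)$. A linear operator is closable if the closure of its graph in $\mathbf{X}\times\mathbf{X}$ is the graph of a linear operator, its closure, denoted by an overline; under the hypotheses (i)–(ii) $C+D$ is closable. For a closable operator $Z$, a function $g:[0,l)\to\mathbf{X}$, $l>0$, is a local solution of $f'=\overline{Z}f$ on $[0,l)$, $f(0)=h\in\mathcal{D}(\overline{Z})$, if $g(s)\in\mathcal{D}(\overline{Z})$ for all $s\in[0,l)$, $g(0)=h$, and $g'(s)=\overline{Z}g(s)$ for all $s\in[0,l)$ (one-sided derivative at $0$). *)

(* Defs.v *)
From HB Require Import structures.
From mathcomp Require Import all_boot all_order all_algebra.
From mathcomp Require Import complex.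
From mathcomp Require Import boolp classical_sets functions set_interval reals.
From mathcomp Require Import topology function_spaces normedtype.

Set Implicit Arguments.
Unset Strict Implicit.
Unset Printing Implicit Defensive.

Import Order.TTheory GRing.Theory Num.Theory.
Import numFieldTopology.Exports numFieldNormedType.Exports.

Local Open Scope classical_set_scope.
Local Open Scope ring_scope.

Variant scalar_kind := RealScalars | ComplexScalars.

Definition scalar_field (R : realType) (k : scalar_kind) : numFieldType :=
  match k with RealScalars => R | ComplexScalars => R[i] end.

Definition of_real (R : realType) (k : scalar_kind) : R -> scalar_field R k :=
  match k with RealScalars => id | ComplexScalars => real_complex R end.

(* Subsequences are given by strictly increasing index maps. *)
Definition subsequences_have_cvg_subsequence (T : topologicalType)
    (u : nat -> T) :=
  forall phi : nat -> nat, {homo phi : m n / (m < n)%N} ->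
  exists2 psi : nat -> nat, {homo psi : m n / (m < n)%N} &
  exists x : T, u \o phi \o psi @ \oo --> x.

Section LocallyConvex.
Context {R : realType} {k : scalar_kind} {X : tvsType (scalar_field R k)}.

Definition seminorm (p : X -> R) :=
  (forall x y, p (x + y) <= p x + p y) /\
  (forall (a : scalar_field R k) x, of_real k (p (a *: x)) = `|a| * of_real k (p x)).

Definition generating_seminorms (Omega : Type) (p : Omega -> X -> R) :=
  (forall alpha, seminorm (p alpha)) /\
  (forall (x : X) (A : set X), nbhs x A <->
    exists (n : nat) (a : 'I_n -> Omega) (e : R), 0 < e /\
      [set y | forall i, p (a i) (y - x) < e] `<=` A).

(* The [entourage]s of a [tvsType] are only required to induce its topology,
   not to be translation invariant, so [cauchy] is not the notion of a Cauchy
   sequence of a topological vector space. *)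
Definition tvs_cauchy_seq (u : nat -> X) :=
  (fun mn : nat * nat => u mn.1 - u mn.2) @ (\oo, \oo) --> (0 : X).

Definition sequentially_complete :=
  forall u : nat -> X, tvs_cauchy_seq u -> exists x : X, u @ \oo --> x.

Definition dual := {phi : X -> (scalar_field R k)^o | linear phi /\ continuous phi}.

(* X with the topology sigma(X, X^* ) *)
Definition weak_space : topologicalType :=
  sup_topology (fun phi : dual =>
    Topological.on (initial_topology (sval phi : X -> (scalar_field R k)^o))).

Definition weakly_cvg (u : nat -> X) (x : X) :=
  (u : nat -> weak_space) @ \oo --> (x : weak_space).

Lemma weakly_cvgP (u : nat -> X) (x : X) :
  weakly_cvg u x <->
  forall phi : dual, (fun n => sval phi (u n)) @ \oo --> sval phi x.
Proof.
split=> [/cvg_sup cvu phi|cvu].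
  apply: (@cvg_comp _ _ _ u (sval phi) _ _ _ (cvu phi)).
  exact: (@initial_continuous X _ (sval phi)).
apply/cvg_sup => phi A [_ [[B oB <-] Bx] BA].
by apply: filterS BA _; apply: cvu; exact: open_nbhs_nbhs.
Qed.

Section Operators.
Variables (Omega : Type) (p : Omega -> X -> R).

Definition seminorm_bounded (A : set X) :=
  forall alpha, exists M : R, forall x, A x -> p alpha x <= M.

Definition bounded_operator (G : X -> X) :=
  linear G /\
  (forall A, seminorm_bounded A -> seminorm_bounded (G @` A)).

Definition equicontinuous_family (Gs : set (X -> X)) :=
  forall alpha, exists (n : nat) (a : 'I_n -> Omega) (b : 'I_n -> R),
    (forall i, 0 < b i) /\
    forall G, Gs G -> forall x, p alpha (G x) <= \sum_i b i * p (a i) x.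

(* Functions on [0, +oo[ are functions on R whose values at negative reals are
   irrelevant. *)
Definition power_family (F : R -> X -> X) (s : R) : set (X -> X) :=
  [set G | exists (n m : nat) (d : R),
    [/\ (0 < n)%N, 0 <= d, m%:R * d / n%:R <= s &
        G = iter m (F (d / n%:R))]].

Definition equicontinuous_powers (F : R -> X -> X) :=
  [/\ forall s : R, 0 <= s -> bounded_operator (F s),
      F 0 =1 id &
      forall s : R, 0 <= s -> equicontinuous_family (power_family F s)].

Definition lC0_semigroup (T : R -> X -> X) :=
  [/\ forall x, {within `[0, +oo[%classic, continuous (fun s => T s x)},
      T 0 =1 id,
      forall l m : R, 0 <= l -> 0 <= m -> T (l + m) =1 T l \o T m &
      equicontinuous_powers T].

End Operators.

(* Unbounded operators in X are represented by their graphs; the closure of an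
   operator is the [closure] of its graph in the product space X * X. *)
Definition domain (Z : set (X * X)) : set X := [set x | exists y, Z (x, y)].

Definition generator (T : R -> X -> X) : set (X * X) :=
  [set z | of_real k h^-1 *: (T h z.1 - z.1) @[h --> 0^'+] --> z.2].

Definition operator_sum (C D : set (X * X)) : set (X * X) :=
  [set z | exists y1 y2, [/\ C (z.1, y1), D (z.1, y2) & z.2 = y1 + y2]].

(* [Z (f s, y)] says that f s lies in the domain of Z and that Z (f s) = y;
   the difference quotient is taken within [0, l[, hence is one-sided at 0. *)
Definition local_solution (Z : set (X * X)) (l : R) (h : X) (f : R -> X) :=
  f 0 = h /\
  forall s : R, 0 <= s < l -> exists y, Z (f s, y) /\
    of_real k (v - s)^-1 *: (f v - f s) @[v --> within `[0, l[ s^'] --> y.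

End LocallyConvex.

Arguments sequentially_complete {R k} X.
Arguments weak_space {R k} X.

(* Main.v *)
(* Put S_m = F(tau)^m for a small step tau. The key estimate is that for (x, y)
   in the closure Z of C + D and every continuous seminorm, S_m x - x - r y is
   small compared with r as soon as r is small, m tau is within tau of r and tau
   is small enough (depending on r). So in the limit tau -> 0 the discrete
   semigroup has Z as a part of its generator, although no resolvent is
   available. If f solves f' = Zf, then s |-> F(tau)^[(b - s)/tau] f(s) has
   derivative zero in the limit, whence F(tau)^[b/tau] h -> f(b); a pointwise
   derivative suffices, f' need not be continuous. Conversely, a diagonal
   argument over the rational times and equicontinuity in s give a subsequence
   along which u_s converges to some f(s) for every s; by (b) and Hahn-Banach f
   takes its values in the domain of Z. Applying the key estimate both to
   (h, Zh) and to (f(s), Zf(s)) shows that F(tau)^[s/tau] Zh -> Zf(s) along the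
   subsequence, and then that f is a solution. *)
From HB Require Import structures.
Require Import Defs.
From mathcomp Require Import all_boot all_order all_algebra.
From mathcomp Require Import ssrAC complex ring lra.
From mathcomp Require Import boolp classical_sets functions reals.
From mathcomp Require Import interval_inference.
From mathcomp Require Import topology function_spaces normedtype.

Set Implicit Arguments.
Unset Strict Implicit.
Unset Printing Implicit Defensive.

Import Order.TTheory GRing.Theory Num.Theory.
Import numFieldTopology.Exports numFieldNormedType.Exports.

Local Open Scope classical_set_scope.
Local Open Scope ring_scope.

(** * Hahn-Banach for real-linear functionals *)

Section HahnBanach.
Variables (R : realType) (K : nzRingType) (iota : {rmorphism R -> K}).
Variable V : lmodType K.
Implicit Types (p f : V -> R) (x y z : V).

(** Homogeneity is asked along [iota] only, so that one Hahn-Banach argument serves both real and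
    complex scalars. *)
Definition sublinear p :=
  (forall x y, p (x + y) <= p x + p y) /\
  (forall r x, 0 <= r -> p (iota r *: x) = r * p x).

Lemma sublinear0 p : sublinear p -> p 0 = 0.
Proof. by case=> _ /(_ 0 0 (lexx 0)); rewrite scaler0 mul0r. Qed.

Lemma sublinear_geN p x : sublinear p -> - p (- x) <= p x.
Proof.
move=> sp; have := sp.1 (- x) x.
by rewrite addNr sublinear0// => ?; lra.
Qed.

(* The ray infimum [inf_(t >= 0) p (x + t y) - t p y] is sublinear, lies below
   [p], and sends [- y] below [- p y]; hence a minimal sublinear [p] is
   additive. *)
Lemma sublinear_descend p y : sublinear p -> exists f,
  [/\ sublinear f, forall x, f x <= p x & forall x, f x <= p (x + y) - p y].
Proof.
move=> sp.
pose E x := [set p (x + iota t *: y) - t * p y | t in [set t : R | 0 <= t]].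
have lbE x : lbound (E x) (- p (- x)).
  move=> _ [t /= t0 <-]; rewrite -(sp.2 t y)//.
  have := sp.1 (x + iota t *: y) (- x).
  by rewrite addrAC subrr add0r => ?; lra.
have infE x : has_inf (E x).
  by split; [exists (p (x + iota 0 *: y) - 0 * p y); exists 0 => /=|
             exists (- p (- x)); exact: lbE].
have leE x t : 0 <= t -> inf (E x) <= p (x + iota t *: y) - t * p y.
  by move=> t0; apply: ge_inf; [exact: (infE x).2|exists t].
exists (fun x => inf (E x)); split; last 2 first.
- by move=> x; have := leE x 0 (lexx 0); rewrite rmorph0 scale0r addr0 mul0r subr0.
- by move=> x; have := leE x 1 ler01; rewrite rmorph1 scale1r mul1r.
split=> [x z|r x r0].
- apply/ler_addgt0Pr => e e0.
  have e20 : 0 < e / 2 by lra.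
  have [_ [t1 /= t10 <-] h1] := inf_adherent e20 (infE x).
  have [_ [t2 /= t20 <-] h2] := inf_adherent e20 (infE z).
  have := leE (x + z) (t1 + t2) (addr_ge0 t10 t20).
  rewrite rmorphD scalerDl addrACA.
  by have := sp.1 (x + iota t1 *: y) (z + iota t2 *: y); lra.
have half r' x' : 0 < r' -> inf (E (iota r' *: x')) <= r' * inf (E x').
  move=> r'0; rewrite -ler_pdivrMl//; apply: lb_le_inf; first exact: (infE x').1.
  move=> _ [t /= t0 <-]; rewrite ler_pdivrMl// mulrBr -(sp.2 _ _ (ltW r'0)).
  rewrite scalerDr scalerA -rmorphM mulrA.
  by apply: leE; rewrite mulr_ge0// ltW.
move: r0; rewrite le_eqVlt => /predU1P[<-|r0].
  rewrite mul0r rmorph0 scale0r; apply/eqP; rewrite eq_le; apply/andP; split.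
    by have := leE 0 0 (lexx 0); rewrite rmorph0 scale0r addr0 mul0r subr0 sublinear0.
  apply: lb_le_inf; first exact: (infE 0).1.
  by move=> _ [t /= t0 <-]; rewrite add0r sp.2// subrr.
apply/eqP; rewrite eq_le half//=.
have := half r^-1 (iota r *: x); rewrite invr_gt0 r0 => /(_ erefl).
by rewrite scalerA -rmorphM mulVf ?gt_eqF// rmorph1 scale1r ler_pdivlMl.
Qed.

(** Zorn's lemma for the reversed pointwise order on the sublinear functions below [p]. A chain is
    bounded by its pointwise infimum, which is finite because every member satisfies
    [f x >= - f (- x) >= - p (- x)]. *)
Lemma minimal_sublinear p : sublinear p -> exists f,
  [/\ sublinear f, forall x, f x <= p x &
      forall g, sublinear g -> (forall x, g x <= f x) -> g = f].
Proof.
move=> sp; pose P f := sublinear f /\ forall x, f x <= p x.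
pose T := {f : V -> R | P f}.
pose rel (f g : T) := `[< forall x, sval g x <= sval f x >].
have [||[f Pf] [g Pg] /asboolP/= fg /asboolP/= gf|A totA|f fmin] := @Zorn T rel.
- by move=> f; apply/asboolP.
- move=> f g h /asboolP fg /asboolP gh; apply/asboolP => x.
  exact: le_trans (gh x) (fg x).
- have e : f = g by apply/funext => x; apply/eqP; rewrite eq_le fg gf.
  by rewrite e in Pf *; congr exist; exact: Prop_irrelevance.
- have [A0|/set0P[f0 Af0]] := eqVneq A set0.
    by exists (exist P p (conj sp (fun=> lexx _))) => s; rewrite A0.
  pose E x := [set sval f x | f in A].
  have lbE x : lbound (E x) (- p (- x)).
    move=> _ [f Af <-]; have [sf fp] := svalP f.
    by apply: le_trans (sublinear_geN x sf); rewrite lerN2.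
  have infE x : has_inf (E x).
    by split; [exists (sval f0 x), f0|exists (- p (- x)); exact: lbE].
  have leE x (f : T) : A f -> inf (E x) <= sval f x.
    by move=> Af; apply: ge_inf; [exact: (infE x).2|exists f].
  have sg : sublinear (fun x => inf (E x)).
    split=> [x y|r x r0].
      apply/ler_addgt0Pr => e e0; have e20 : 0 < e / 2 by lra.
      have [_ [f Af <-] hf] := inf_adherent e20 (infE x).
      have [_ [g Ag <-] hg] := inf_adherent e20 (infE y).
      have sf := (svalP f).1; have sg := (svalP g).1.
      (* Subadditivity needs one member that is almost minimal at both points: the smaller of [f]
         and [g] is. *)
      have [/asboolP fg|/asboolP gf] := totA f g Af Ag.
        by have := leE (x + y) _ Ag; have := sg.1 x y; have := fg x; lra.
      by have := leE (x + y) _ Af; have := sf.1 x y; have := gf y; lra.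
    have -> : E (iota r *: x) = [set r * z | z in E x].
      apply/seteqP; split=> [_ [f Af <-]|_ [_ [f Af <-] <-]].
        by exists (sval f x); [exists f|rewrite (svalP f).1.2].
      by exists f => //; rewrite (svalP f).1.2.
    move: r0; rewrite le_eqVlt => /predU1P[<-|r0].
      rewrite mul0r -[RHS](inf1 (0 : R)); congr inf; apply/seteqP; split=> z /=.
        by case=> y _ <-; rewrite mul0r.
      by move=> ->; exists (sval f0 x); [exists f0|rewrite mul0r].
    have [x0 bx] := infE x.
    apply/eqP; rewrite eq_le; apply/andP; split.
      rewrite -ler_pdivrMl//; apply: lb_le_inf => // y Ey.
      rewrite ler_pdivrMl//; apply: ge_inf; last by exists y.
      exists (r * inf (E x)) => _ [z Ez <-].
      by rewrite ler_pM2l//; exact: ge_inf.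
    apply: lb_le_inf; first by case: x0 => y Ey; exists (r * y), y.
    by move=> _ [y Ey <-]; rewrite ler_pM2l//; exact: ge_inf.
  have gp x : inf (E x) <= p x.
    by apply: le_trans ((svalP f0).2 x); exact: leE.
  exists (exist P _ (conj sg gp)) => f Af; apply/asboolP => x /=; exact: leE.
case: f fmin => f [sf fp] fmin; exists f; split=> // g sg gf.
have gp x : g x <= p x by exact: le_trans (gf x) (fp x).
have -> // : g = sval (exist P f (conj sf fp)).
by rewrite -(fmin (exist P g (conj sg gp)))//; exact/asboolP.
Qed.

(** Descending at [z] first gives [f0 (- z) <= - p z], which forces [L z >= p z] for every linear
    [L] below [f0]. A minimal [L] below [f0] is additive, since its own descent at any [y] must
    coincide with it. *)
Lemma hahn_banach p z : sublinear p -> exists L : V -> R,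
  [/\ {morph L : x y / x + y}, forall r x, L (iota r *: x) = r * L x,
      forall x, L x <= p x & L z = p z].
Proof.
move=> sp.
have [f0 [sf0 f0p f0z]] := sublinear_descend z sp.
have [L [sL Lf0 Lmin]] := minimal_sublinear sf0.
have LD x y : L (x + y) = L x + L y.
  apply/eqP; rewrite eq_le sL.1/=.
  have [g [sg gL gy]] := sublinear_descend y sL.
  by have := gy x; rewrite (Lmin g sg gL) lerBrDr.
have LN x : L (- x) = - L x.
  by apply/eqP; rewrite -addr_eq0 -LD addNr sublinear0.
exists L; split=> // [r x|x|].
- have [r0|r0] := leP 0 r; first exact: sL.2.
  rewrite -[r]opprK rmorphN scaleNr LN sL.2 ?mulNr//; lra.
- exact: le_trans (Lf0 x) (f0p x).
- apply/eqP; rewrite eq_le (le_trans (Lf0 z) (f0p z))/=.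
  have := le_trans (Lf0 (- z)) (f0z (- z)).
  by rewrite addNr sublinear0// LN sub0r lerN2.
Qed.

End HahnBanach.

(** * Continuous seminorms *)

Section ScalarField.
Variables (R : realType) (k : scalar_kind).

Lemma of_real_is_zmod_morphism : zmod_morphism (@of_real R k).
Proof. by case: k => x y //=; rewrite rmorphB. Qed.

Lemma of_real_is_monoid_morphism : monoid_morphism (@of_real R k).
Proof. by case: k => /=; split=> // x y; rewrite ?rmorph1 ?rmorphM. Qed.

HB.instance Definition _ := GRing.isZmodMorphism.Build R (scalar_field R k)
  (@of_real R k) of_real_is_zmod_morphism.
HB.instance Definition _ := GRing.isMonoidMorphism.Build R (scalar_field R k)
  (@of_real R k) of_real_is_monoid_morphism.

Lemma of_real_inj : injective (@of_real R k).
Proof. by case: k => x y //= []. Qed.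

Lemma ler_of_real (x y : R) : (of_real k x <= of_real k y) = (x <= y).
Proof. by case: k => //=; rewrite lecR. Qed.

Lemma ltr_of_real (x y : R) : (of_real k x < of_real k y) = (x < y).
Proof. by case: k => //=; rewrite ltcR. Qed.

Lemma norm_of_real (x : R) : `|of_real k x| = of_real k `|x|.
Proof.
have [x0|/ltW x0] := leP 0 x.
  by rewrite !ger0_norm// -[0](rmorph0 (of_real k)) ler_of_real.
by rewrite !ler0_norm ?rmorphN// -[0](rmorph0 (of_real k)) ler_of_real.
Qed.

(** In the order of the complex numbers a positive element has zero imaginary part, so [e] is
    already real. *)
Lemma of_real_archi (e : scalar_field R k) : 0 < e ->
  exists2 d : R, 0 < d & of_real k d <= e.
Proof.
case: k e => /= e e0; first by exists e.
case: e e0 => a b; rewrite ltcE /= => /andP[/eqP-> a0].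
by exists a.
Qed.

End ScalarField.

Section Seminorms.
Context {R : realType} {k : scalar_kind} {X : tvsType (scalar_field R k)}.
Implicit Types (q : X -> R) (x y z : X).

Section Seminorm.
Variable q : X -> R.
Hypothesis sq : seminorm q.

Lemma seminormZ (r : R) x : q (of_real k r *: x) = `|r| * q x.
Proof.
by apply: (@of_real_inj R k); rewrite sq.2 norm_of_real rmorphM.
Qed.

Lemma seminorm0 : q 0 = 0.
Proof. by rewrite -(scale0r (0 : X)) -(rmorph0 (of_real k)) seminormZ normr0 mul0r. Qed.

Lemma seminormN x : q (- x) = q x.
Proof.
by rewrite -scaleN1r -(rmorph1 (of_real k)) -rmorphN seminormZ normrN1 mul1r.
Qed.

Lemma seminorm_ge0 x : 0 <= q x.
Proof.
have := sq.1 x (- x); rewrite subrr seminorm0 seminormN => h; lra.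
Qed.

Lemma seminormC x y : q (x - y) = q (y - x).
Proof. by rewrite -seminormN opprB. Qed.

Lemma seminorm_triangle z x y : q (x - y) <= q (x - z) + q (z - y).
Proof. by have := sq.1 (x - z) (z - y); rewrite addrA subrK. Qed.

Lemma seminorm_split x y : q x <= q (x - y) + q y.
Proof. by have := sq.1 (x - y) y; rewrite subrK. Qed.

Lemma seminorm_sum n (F : nat -> X) : q (\sum_(j < n) F j) <= \sum_(j < n) q (F j).
Proof.
elim: n => [|n IH]; first by rewrite !big_ord0 seminorm0.
by rewrite !big_ord_recr /=; apply: le_trans (sq.1 _ _) _; rewrite lerD2r.
Qed.

Lemma seminorm_scaled_sum (c h : R) m (f : nat -> X) : 0 <= h ->
  (forall j, (j < m)%N -> q (f j) <= c) ->
  q (of_real k h *: \sum_(j < m) f j) <= m%:R * h * c.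
Proof.
move=> h0 hc; rewrite seminormZ ger0_norm// mulrAC [leRHS]mulrC.
rewrite ler_wpM2l//; apply: le_trans (seminorm_sum _ _) _.
apply: (@le_trans _ _ (\sum_(j < m) c)); first by apply: ler_sum => j _; exact: hc.
by rewrite sumr_const card_ord mulr_natl.
Qed.

End Seminorm.

Section ContinuousSeminorms.
Variables (Omega : Type) (p : Omega -> X -> R).
Hypothesis hp : generating_seminorms p.

(** Domination by finitely many generators amounts to continuity. The class is stable under sums and
    nonnegative multiples, so each later estimate runs with a single seminorm. *)
Definition continuous_seminorm q := seminorm q /\
  exists (s : seq Omega) (M : R), 0 <= M /\
    forall x, q x <= M * \sum_(a <- s) p a x.

Let p_ge0 a x : 0 <= p a x.
Proof. exact: (seminorm_ge0 (hp.1 a)). Qed.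

Let sum_ge0 (s : seq Omega) x : 0 <= \sum_(a <- s) p a x.
Proof. by apply: sumr_ge0. Qed.

Lemma csn_gen a : continuous_seminorm (p a).
Proof.
split; first exact: hp.1.
by exists [:: a], 1; split=> // x; rewrite big_seq1 mul1r.
Qed.

Lemma csnD q1 q2 : continuous_seminorm q1 -> continuous_seminorm q2 ->
  continuous_seminorm (fun x => q1 x + q2 x).
Proof.
move=> [s1 [a1 [M1 [M10 h1]]]] [s2 [a2 [M2 [M20 h2]]]]; split.
  split=> [x y|a x]; first by rewrite addrACA lerD ?s1.1 ?s2.1.
  by rewrite !rmorphD/= mulrDr s1.2 s2.2.
exists (a1 ++ a2), (M1 + M2); split=> [|x]; first exact: addr_ge0.
rewrite big_cat/= mulrDl !mulrDr.
have := mulr_ge0 M10 (sum_ge0 a2 x); have := mulr_ge0 M20 (sum_ge0 a1 x).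
by have := h1 x; have := h2 x; lra.
Qed.

Lemma csnZ c q : 0 <= c -> continuous_seminorm q ->
  continuous_seminorm (fun x => c * q x).
Proof.
move=> c0 [sq [s [M [M0 h]]]]; split.
  split=> [x y|a x]; first by rewrite -mulrDr ler_wpM2l// sq.1.
  by rewrite !rmorphM/= sq.2 mulrCA.
exists s, (c * M); split=> [|x]; first exact: mulr_ge0.
by rewrite -mulrA ler_wpM2l.
Qed.

Lemma csn0 : continuous_seminorm (fun=> 0).
Proof.
split; first by split=> [x y|a x]; rewrite ?addr0// rmorph0 mulr0.
by exists [::], 0; split=> // x; rewrite mul0r.
Qed.

Lemma csn_sum n (f : 'I_n -> X -> R) : (forall i, continuous_seminorm (f i)) ->
  continuous_seminorm (fun x => \sum_(i < n) f i x).
Proof.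
elim: n f => [f _|n IH f cf].
  by under eq_fun do rewrite big_ord0; exact: csn0.
under eq_fun do rewrite big_ord_recr.
by apply: csnD => //; apply: IH.
Qed.

Lemma nbhs_csnP x (A : set X) : nbhs x A <->
  exists2 q, continuous_seminorm q & forall y, q (y - x) < 1 -> A y.
Proof.
split=> [/hp.2[n [a [e [e0 sA]]]]|[q [sq [s [M [M0 h]]]] qA]].
  exists (fun y => e^-1 * \sum_(i < n) p (a i) y).
    apply: csnZ; first by rewrite invr_ge0 ltW.
    by apply: csn_sum => i; exact: csn_gen.
  move=> y; rewrite ltr_pdivrMl// mulr1 => hy; apply: sA => i.
  apply: le_lt_trans hy; rewrite (bigD1 i)//= lerDl; exact: sumr_ge0.
apply/hp.2; exists (size s), (tnth (in_tuple s)).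
(* The summand 1 covers [M = 0] and empty [s], and makes the final inequality strict. *)
have D0 : 0 < M * (size s)%:R + 1 by rewrite ltr_wpDl// mulr_ge0.
exists (M * (size s)%:R + 1)^-1; split; first by rewrite invr_gt0.
move=> y /= hy; apply: qA; apply: le_lt_trans (h _) _.
rewrite big_tnth.
apply: (@le_lt_trans _ _ (M * \sum_(i < size s) (M * (size s)%:R + 1)^-1)).
  by rewrite ler_wpM2l// ler_sum// => i _; exact: ltW.
by rewrite sumr_const card_ord -[X in M * X]mulr_natl mulrA ltr_pdivrMr// mul1r ltrDl.
Qed.

Lemma nbhs_csn q x (e : R) : continuous_seminorm q -> 0 < e ->
  nbhs x [set y | q (y - x) < e].
Proof.
move=> cq e0; apply/nbhs_csnP; exists (fun y => e^-1 * q y).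
  by apply: csnZ => //; rewrite invr_ge0 ltW.
by move=> y; rewrite ltr_pdivrMl// mulr1.
Qed.

Lemma cvg_csnP T (F : set_system T) {FF : Filter F} (f : T -> X) x :
  f @ F --> x <-> forall q (e : R), continuous_seminorm q -> 0 < e ->
    \forall t \near F, q (f t - x) < e.
Proof.
split=> [fx q e cq e0|h A /nbhs_csnP[q cq qA]].
  exact: (fx _ (nbhs_csn x cq e0)).
by apply: filterS (h q 1 cq ltr01) => t; exact: qA.
Qed.

Lemma closure_csnP (S : set (X * X)) (z : X * X) : closure S z <->
  forall q (e : R), continuous_seminorm q -> 0 < e ->
    exists w, [/\ S w, q (w.1 - z.1) < e & q (w.2 - z.2) < e].
Proof.
case: z => x y; split=> [cS q e cq e0|h B [[B1 B2] /= [nB1 nB2] sB]].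
  have [|w [Sw [w1 w2]]] := cS [set w | q (w.1 - x) < e /\ q (w.2 - y) < e].
    exists ([set u | q (u - x) < e], [set u | q (u - y) < e]) => //=.
    by split; exact: nbhs_csn.
  by exists w.
have [q1 cq1 h1] := (nbhs_csnP _ _).1 nB1.
have [q2 cq2 h2] := (nbhs_csnP _ _).1 nB2.
have [w [Sw w1 w2]] := h _ 1 (csnD cq1 cq2) ltr01.
exists w; split=> //; apply: sB; split=> /=.
  by apply: h1; apply: le_lt_trans w1; rewrite lerDl (seminorm_ge0 cq2.1).
by apply: h2; apply: le_lt_trans w2; rewrite lerDr (seminorm_ge0 cq1.1).
Qed.

(** Induction on the list of generators dominating [q]: their individual bounds add up.
    Equicontinuity then costs only the passage from [q] to [q'], uniformly in [G]. *)
Lemma equicontinuous_csn Gs q : equicontinuous_family p Gs ->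
  continuous_seminorm q ->
  exists2 q', continuous_seminorm q' & forall G, Gs G -> forall x, q (G x) <= q' x.
Proof.
move=> eG [_ [s [M [M0 h]]]].
suff [q' cq' h'] : exists2 q', continuous_seminorm q' &
    forall G, Gs G -> forall x, \sum_(a <- s) p a (G x) <= q' x.
  exists (fun x => M * q' x); first exact: csnZ.
  by move=> G GG x; apply: le_trans (h _) _; rewrite ler_wpM2l// h'.
elim: s {h} => [|a s [q' cq' h']].
  by exists (fun=> 0); [exact: csn0|move=> G _ x; rewrite big_nil].
have [n [b [c [c0 hb]]]] := eG a.
exists (fun x => \sum_(i < n) c i * p (b i) x + q' x).
  by apply: csnD => //; apply: csn_sum => i; apply: csnZ;
    [exact: ltW|exact: csn_gen].
by move=> G GG x; rewrite big_cons lerD ?hb ?h'.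
Qed.

Lemma dense_csn (S : set X) q y (e : R) : dense S -> continuous_seminorm q -> 0 < e ->
  exists2 x, S x & q (x - y) < e.
Proof.
move=> dS cq e0; pose O := (interior [set u | q (u - y) < e] : set X).
have yO : O y by exact: (nbhs_csn y cq e0).
have [|x [Ox Sx]] := dS O _ (open_interior _); first by exists y.
by exists x => //; exact: interior_subset Ox.
Qed.

(** Multiplying by [|v - s|] removes the inverse and makes [v = s] harmless. *)
Lemma difference_quotient_csnP (l s : R) (f : R -> X) y :
  of_real k (v - s)^-1 *: (f v - f s) @[v --> within `[0, l[ s^'] --> y <->
  forall q (e : R), continuous_seminorm q -> 0 < e -> exists2 d : R, 0 < d &
    forall v, 0 <= v < l -> `|v - s| < d ->
      q (f v - f s - of_real k (v - s) *: y) <= e * `|v - s|.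
Proof.
have E q v : continuous_seminorm q -> v != s -> q (f v - f s - of_real k (v - s) *: y) =
    `|v - s| * q (of_real k (v - s)^-1 *: (f v - f s) - y).
  move=> cq vs; rewrite -(seminormZ cq.1) scalerBr scalerA -rmorphM.
  by rewrite divff ?subr_eq0// rmorph1 scale1r.
split=> [/(cvg_csnP) fy q e cq e0|H].
  have := fy q e cq e0.
  rewrite near_withinE near_withinE => /nbhs_ballP[d /= d0 hd].
  exists d => // v vl vd.
  have [->|vs] := eqVneq v s.
    by rewrite !subrr rmorph0 scale0r subrr (seminorm0 cq.1) normr0 mulr0.
  rewrite E// mulrC ler_wpM2r//; apply/ltW/hd => //.
    by rewrite /ball/= distrC.
apply/(cvg_csnP) => q e cq e0.
have e20 : 0 < e / 2 by lra.
have [d d0 hd] := H q _ cq e20.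
rewrite near_withinE near_withinE; apply/nbhs_ballP; exists d => //= v.
rewrite /ball/= distrC in_itv/= => vd vs vl.
have := hd v vl vd; rewrite E// mulrC ler_pM2r ?normr_gt0 ?subr_eq0// => h; lra.
Qed.

End ContinuousSeminorms.
End Seminorms.

(** * Integer parts and induction along a real interval *)

Section RealLine.
Variable R : realType.
Implicit Types a b c d e h s v w : R.

Lemma near_right_lt e : 0 < e -> \forall h \near 0^'+, 0 < h < e.
Proof.
move=> e0; near=> h; apply/andP; split; near: h.
  exact: nbhs_right_gt.
exact: nbhs_right_lt.
Unshelve. all: by end_near. Qed.

Lemma truncn_mul_le c h : 0 < h -> 0 <= c -> (Num.truncn (c / h))%:R * h <= c.
Proof.
move=> h0 c0; rewrite -ler_pdivlMr//.
by case/andP: (truncn_itv (divr_ge0 c0 (ltW h0))).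
Qed.

(** Each integer part is within one of its argument, so their difference is within one of
    [(c - a) / h]. It serves to split [F(h)^[c/h]] into [F(h)^[a/h]] and [m] further steps that
    cover the time [c - a] up to [h]. *)
Lemma truncn_increment a c h : 0 < h -> 0 <= a -> a <= c ->
  exists2 m, Num.truncn (c / h) = (Num.truncn (a / h) + m)%N &
    `|m%:R * h - (c - a)| <= h.
Proof.
move=> h0 a0 ac; have ch : a / h <= c / h by rewrite ler_pM2r ?invr_gt0.
exists (Num.truncn (c / h) - Num.truncn (a / h))%N; first by rewrite subnKC// le_truncn.
have /andP[a1 a2] := truncn_itv (divr_ge0 a0 (ltW h0)).
have /andP[c1 c2] := truncn_itv (divr_ge0 (le_trans a0 ac) (ltW h0)).
move: a1 a2 c1 c2; rewrite ler_pdivlMr// ltr_pdivrMr// ler_pdivlMr// ltr_pdivrMr//.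
rewrite natrB ?le_truncn// ler_norml -!natr1; lra.
Qed.

(** A substitute for compactness in which [d] may depend on [s]. The transfer only has to work
    across [s], from [v <= s] to [w >= s], because a derivative at [s] compares other values with
    the value at [s] alone. *)
Lemma real_induction b (P : R -> Prop) : 0 <= b -> P 0 ->
  (forall s, 0 <= s <= b -> exists2 d, 0 < d & forall v w,
    0 <= v <= s -> s <= w <= b -> s - d < v -> w < s + d -> P v -> P w) ->
  P b.
Proof.
move=> b0 P0 step; pose E := [set s | 0 <= s <= b /\ P s].
have E0 : E 0 by rewrite /E/= lexx b0.
have ubE : ubound E b by move=> s [/andP[]].
have supE : has_sup E by split; [exists 0|exists b].
have c0 : 0 <= sup E by apply: sup_upper_bound.
have cb : sup E <= b by apply: ge_sup => //; exists 0.
have [|d d0 hd] := step (sup E); first by rewrite c0.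
have [v [/andP[v0 vb] Pv] dv] := sup_adherent d0 supE.
have vc : v <= sup E by apply: sup_upper_bound => //; split=> //; rewrite v0.
(* Either [b] is within reach of the supremum, or [P] would hold at a point beyond the supremum. *)
have [bd|db] := ltP b (sup E + d).
  by apply: (hd v b) => //; rewrite ?v0 ?cb ?lexx.
have Ew : E (sup E + d / 2).
  split; first by apply/andP; split; lra.
  by apply: (hd v) => //; [rewrite v0|apply/andP; split; lra|lra].
by have := sup_upper_bound supE Ew; lra.
Qed.

Lemma cvg_divn (t : R) : 0 < t -> t / n.+1%:R @[n --> \oo] --> 0^'+.
Proof.
move=> t0 P /nbhs_ballP[e /= e0 eP]; suff : \forall n \near \oo, P (t / n.+1%:R) by [].
near=> n; apply: eP; last by rewrite divr_gt0.
rewrite /ball/= sub0r normrN gtr0_norm ?divr_gt0// -ltr_pdivlMl// mulrC.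
by near: n; exact: near_infty_natSinv_lt (PosNum (divr_gt0 e0 t0)).
Unshelve. all: by end_near. Qed.

End RealLine.

(** * Powers of a family with equicontinuous powers *)

Section Chernoff.
Context {R : realType} {k : scalar_kind} {X : tvsType (scalar_field R k)}.
Variables (Omega : Type) (p : Omega -> X -> R).
Hypothesis hp : generating_seminorms p.
Variable F : R -> X -> X.
Hypothesis eF : equicontinuous_powers p F.
Variable A : set (X * X).
Hypothesis derivF : forall x y, A (x, y) ->
  of_real k h^-1 *: (F h x - x) @[h --> 0^'+] --> y.
Hypothesis denseA : dense (domain A).
Local Notation csn := (continuous_seminorm p).
Implicit Types (q : X -> R) (x y z : X) (b c d e h r s v : R).

Lemma pow_lin (h : R) m : 0 <= h -> linear (iter m (F h)).
Proof.
move=> h0; have [/(_ h h0)[lF _] _ _] := eF.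
by elim: m => // m IH a x y; rewrite !iterS IH lF.
Qed.

Lemma powB h m x y : 0 <= h ->
  iter m (F h) (x - y) = iter m (F h) x - iter m (F h) y.
Proof.
by move=> h0; rewrite -scaleN1r [x + _]addrC (pow_lin m h0) scaleN1r addrC.
Qed.

Lemma pow0 h m : 0 <= h -> iter m (F h) 0 = 0.
Proof. by move=> h0; rewrite -{1}(subrr (0 : X)) powB// subrr. Qed.

Lemma powZ h m a x : 0 <= h -> iter m (F h) (a *: x) = a *: iter m (F h) x.
Proof. by move=> h0; have := pow_lin m h0 a x 0; rewrite pow0// !addr0. Qed.

Lemma powD h m x y : 0 <= h ->
  iter m (F h) (x + y) = iter m (F h) x + iter m (F h) y.
Proof. by move=> h0; have := pow_lin m h0 1 x y; rewrite !scale1r. Qed.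

(** [F(h)^m] with [m h <= c] lies in [power_family F c], with denominator 1. The exponent 0 yields
    [q <= q']. *)
Lemma pow_equicontinuous q c : 0 <= c -> csn q ->
  exists2 q', csn q' & (forall x, q x <= q' x) /\
    forall h m x, 0 < h -> m%:R * h <= c -> q (iter m (F h) x) <= q' x.
Proof.
move=> c0 cq; have [_ _ /(_ c c0) eG] := eF.
have [q' cq' hq'] := equicontinuous_csn hp eG cq; exists q' => //.
have bound h m x : 0 <= h -> m%:R * h <= c -> q (iter m (F h) x) <= q' x.
  by move=> h0 mh; apply: hq'; exists 1%N, m, h; rewrite !divr1.
split=> [x|h m x /ltW]; last exact: bound.
by have := bound 0 0%N x (lexx 0); rewrite mul0r; apply.
Qed.

Lemma deriv_csn x y q (e : R) : A (x, y) -> csn q -> 0 < e ->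
  \forall h \near 0^'+, q (F h x - x - of_real k h *: y) <= e * h.
Proof.
move=> /derivF/(cvg_csnP hp) Axy cq e0.
near=> h; have h0 : 0 < h by near: h; exact: nbhs_right_gt.
have : q (of_real k h^-1 *: (F h x - x) - y) < e by near: h; exact: Axy.
rewrite -(ltr_pM2l h0) -{1}(gtr0_norm h0) -(seminormZ cq.1) scalerBr scalerA.
by rewrite -rmorphM divff ?gt_eqF// rmorph1 scale1r mulrC => /ltW.
Unshelve. all: by end_near. Qed.

Lemma pow_telescope h m x : 0 <= h ->
  iter m (F h) x - x = \sum_(j < m) iter j (F h) (F h x - x).
Proof.
move=> h0; elim: m => [|m IH]; first by rewrite big_ord0 subrr.
by rewrite big_ord_recr/= -IH powB// -iterSr [RHS]addrC subrKA.
Qed.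

(** Telescoping writes [F(h)^m x - x] as a sum of [F(h)^j (F(h) x - x)]. For a nearby [(x', y')] in
    [A] each summand is [h F(h)^j y'] up to o(h), and [m h <= c] keeps the total error small;
    equicontinuity absorbs the passage from [(x, y)] to [(x', y')]. *)
Lemma pow_expansion x y q c (e : R) : closure A (x, y) -> csn q ->
  0 <= c -> 0 < e ->
  \forall h \near 0^'+, forall m, m%:R * h <= c ->
    q (iter m (F h) x - x - of_real k h *: \sum_(j < m) iter j (F h) y) <= e.
Proof.
move=> clA cq c0 e0.
have [q' cq' [qq' hq']] := pow_equicontinuous c0 cq.
(* The four errors below are at most [d], [d], [d * c] and [d * c]. *)
pose d := e / (2 + 2 * c).
have dc : d * (2 + 2 * c) = e by rewrite divfK// gt_eqF//; lra.
have d0 : 0 < d by rewrite divr_gt0//; lra.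
have [[x' y'] /= [A' x'x y'y]] := (closure_csnP hp _ _).1 clA _ _ cq' d0.
near=> h => m mh.
have h0 : 0 < h by near: h; exact: nbhs_right_gt.
have jm j : (j < m)%N -> j%:R * h <= c.
  by move=> jm; apply: le_trans mh; rewrite ler_pM2r// ler_nat ltnW.
have E : iter m (F h) x - x - of_real k h *: \sum_(j < m) iter j (F h) y =
    (x' - x) - iter m (F h) (x' - x)
    + \sum_(j < m) iter j (F h) (F h x' - x' - of_real k h *: y')
    + of_real k h *: \sum_(j < m) iter j (F h) (y' - y).
  under [in RHS]eq_bigr do rewrite powB ?powZ ?(ltW h0)//.
  under [X in _ + of_real k h *: X]eq_bigr do rewrite powB ?(ltW h0)//.
  rewrite !sumrB -scaler_sumr scalerBr -pow_telescope ?(ltW h0)// powB ?(ltW h0)//.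
  rewrite opprB !addrA !subrK; congr (_ - _).
  by rewrite -2!addrA [x' + _]addrC addrA subrK addrC.
rewrite E -dc.
have b1 : q (x' - x) <= d by apply: le_trans (qq' _) _; exact: ltW.
have b2 : q (iter m (F h) (x' - x)) <= d.
  by apply: le_trans (hq' _ _ _ h0 mh) _; exact: ltW.
have b3 : q (\sum_(j < m) iter j (F h) (F h x' - x' - of_real k h *: y')) <= d * c.
  apply: le_trans (seminorm_sum cq.1 _ _) _.
  apply: (@le_trans _ _ (\sum_(j < m) (d * h))).
    apply: ler_sum => j _; apply: le_trans (hq' _ _ _ h0 (jm j (ltn_ord j))) _.
    near: h; exact: deriv_csn.
  by rewrite sumr_const card_ord -[leLHS]mulr_natl mulrCA ler_pM2l.
have b4 : q (of_real k h *: \sum_(j < m) iter j (F h) (y' - y)) <= d * c.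
  apply: le_trans (seminorm_scaled_sum (c := d) cq.1 (ltW h0) _) _.
    move=> j jm'; apply: le_trans (hq' _ _ _ h0 (jm j jm')) _; exact: ltW.
  by rewrite [leLHS]mulrC ler_pM2l.
apply: le_trans (cq.1.1 _ _) _.
have := cq.1.1 ((x' - x) - iter m (F h) (x' - x))
  (\sum_(j < m) iter j (F h) (F h x' - x' - of_real k h *: y')).
have := cq.1.1 (x' - x) (- iter m (F h) (x' - x)).
by rewrite (seminormN cq.1); lra.
Unshelve. all: by end_near. Qed.

(** On a nearby [x'] in the domain, with image [w], the expansion gives a displacement of order
    [m h]; density and equicontinuity carry this over to [y]. *)
Lemma pow_near_id y q e : csn q -> 0 < e ->
  exists2 d : R, 0 < d & \forall h \near 0^'+, forall m, m%:R * h <= d ->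
    q (iter m (F h) y - y) <= e.
Proof.
move=> cq e0; have [q' cq' [qq' hq']] := pow_equicontinuous ler01 cq.
have e40 : 0 < e / 4 by lra.
have [x' [w Axw] x'y] := dense_csn hp y denseA cq' e40.
have D0 : 0 < 4 * (q' w + 1) by have := seminorm_ge0 cq'.1 w; lra.
(* The bound 1 is the time span of the equicontinuity estimate; the other makes
   [m h * q' w <= e / 4]. *)
exists (Num.min 1 (e / (4 * (q' w + 1)))); first by rewrite lt_min ltr01 divr_gt0.
near=> h => m; rewrite le_min => /andP[m1 md].
have h0 : 0 < h by near: h; exact: nbhs_right_gt.
have b1 : q (iter m (F h) (y - x')) <= e / 4.
  by apply: le_trans (hq' _ _ _ h0 m1) _; rewrite (seminormC cq'.1) ltW.
have b2 : q (x' - y) <= e / 4 by apply: le_trans (qq' _) _; exact: ltW.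
have b3 : q (iter m (F h) x' - x' - of_real k h *: \sum_(j < m) iter j (F h) w) <= e / 4.
  move: m m1 {md b1}; near: h; apply: pow_expansion => //.
  exact: subset_closure.
have b4 : q (of_real k h *: \sum_(j < m) iter j (F h) w) <= e / 4.
  apply: le_trans (seminorm_scaled_sum (c := q' w) cq.1 (ltW h0) _) _.
    move=> j jm; apply: hq' => //; apply: le_trans m1.
    by rewrite ler_pM2r// ler_nat ltnW.
  move: md; rewrite ler_pdivlMr//; have := seminorm_ge0 cq'.1 w.
  have := mulr_ge0 (ler0n R m) (ltW h0); nra.
have := seminorm_split cq.1 (iter m (F h) x' - x')
  (of_real k h *: \sum_(j < m) iter j (F h) w).
have := seminorm_triangle cq.1 (iter m (F h) x') (iter m (F h) y) y.
have := seminorm_triangle cq.1 x' (iter m (F h) x') y.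
rewrite -powB ?(ltW h0)//; lra.
Unshelve. all: by end_near. Qed.

(** The key estimate. In the expansion of [F(h)^m x - x], replacing every [F(h)^j y] by [y] costs
    little because all times [j h] are short, and replacing [m h] by [r] costs at most [h * q y].
    The error must be small relative to [r], so [r] is fixed before [h]. *)
Lemma pow_deriv x y q e : closure A (x, y) -> csn q -> 0 < e ->
  exists2 d : R, 0 < d & forall r, 0 < r < d ->
    \forall h \near 0^'+, forall m, `|m%:R * h - r| <= h ->
      q (iter m (F h) x - x - of_real k r *: y) <= e * r /\
      q (iter m (F h) y - y) <= e.
Proof.
move=> clA cq e0; have e40 : 0 < e / 4 by lra.
have [d d0 hd] := pow_near_id y cq e40.
(* With [h < r < d / 2] the elapsed time [m h <= r + h] stays below [d]. *)
exists (d / 2); first by lra.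
move=> r /andP[r0 rd].
have er0 : 0 < e * r / 4 by rewrite divr_gt0// mulr_gt0.
have D0 : 0 < q y + 1 by have := seminorm_ge0 cq.1 y; lra.
near=> h => m mhr.
have h0 : 0 < h by near: h; exact: nbhs_right_gt.
have hr : h < r by near: h; exact: nbhs_right_lt.
have hqy : h < e * r / 4 / (q y + 1) by near: h; apply: nbhs_right_lt; exact: divr_gt0.
have mhd : m%:R * h <= d by move: mhr; rewrite ler_norml; lra.
have hd' : forall m, m%:R * h <= d -> q (iter m (F h) y - y) <= e / 4 by near: h.
split; last by apply: le_trans (hd' _ mhd) _; lra.
have b1 : q (iter m (F h) x - x - of_real k h *: \sum_(j < m) iter j (F h) y) <= e * r / 4.
  by move: m mhd {mhr}; near: h; apply: pow_expansion => //; exact: ltW.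
have b2 : q (of_real k h *: \sum_(j < m) (iter j (F h) y - y)) <= e / 4 * (r + h).
  apply: le_trans (seminorm_scaled_sum (c := e / 4)
      (f := fun j => iter j (F h) y - y) cq.1 (ltW h0) _) _.
    move=> j jm; apply: hd'; apply: le_trans mhd.
    by rewrite ler_pM2r// ler_nat ltnW.
  rewrite [leLHS]mulrC ler_pM2l//.
  by move: mhr; rewrite ler_norml; lra.
have b3 : q (of_real k (m%:R * h - r) *: y) <= e * r / 4.
  rewrite (seminormZ cq.1); apply: (@le_trans _ _ (h * q y)).
    by rewrite ler_wpM2r// (seminorm_ge0 cq.1).
  by move: hqy; rewrite ltr_pdivlMr//; lra.
have -> : iter m (F h) x - x - of_real k r *: y =
    (iter m (F h) x - x - of_real k h *: \sum_(j < m) iter j (F h) y)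
    + of_real k h *: \sum_(j < m) (iter j (F h) y - y)
    + of_real k (m%:R * h - r) *: y.
  rewrite sumrB sumr_const card_ord scalerBr addrA subrK -scaler_nat scalerA.
  by rewrite rmorphB scalerBl rmorphM rmorph_nat mulrC addrA subrK.
have := cq.1.1 ((iter m (F h) x - x - of_real k h *: \sum_(j < m) iter j (F h) y)
    + of_real k h *: \sum_(j < m) (iter j (F h) y - y)) (of_real k (m%:R * h - r) *: y).
have := cq.1.1 (iter m (F h) x - x - of_real k h *: \sum_(j < m) iter j (F h) y)
    (of_real k h *: \sum_(j < m) (iter j (F h) y - y)).
have : e * h <= e * r by rewrite ler_pM2l// ltW.
lra.
Unshelve. all: by end_near. Qed.

(** * A local solution is the limit of the powers *)

Section LocalSolution.
Variables (l : R) (x0 : X) (f : R -> X).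
Hypothesis solf : local_solution (closure A) l x0 f.

(** The map [s |-> F(h)^[(b - s)/h] (f s)] has derivative zero in the limit: moving from [s] to [v]
    changes [f] by about [(v - s) y], while the change in the number of steps contributes about
    [- (v - s) y]. *)
Lemma pow_solution_increment b s q e : 0 <= s <= b -> b < l -> csn q -> 0 < e ->
  exists2 d : R, 0 < d & forall v, 0 <= v <= b -> `|v - s| < d ->
    \forall h \near 0^'+,
      q (iter (Num.truncn ((b - v) / h)) (F h) (f v)
         - iter (Num.truncn ((b - s) / h)) (F h) (f s)) <= e * `|v - s|.
Proof.
move=> /andP[s0 sb] bl cq e0.
have sl : 0 <= s < l by rewrite s0 (le_lt_trans sb).
have [y [Zy /(difference_quotient_csnP hp) df]] := solf.2 s sl.
have b0 : 0 <= b by exact: le_trans sb.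
have [q' cq' [_ hq']] := pow_equicontinuous b0 cq.
have e40 : 0 < e / 4 by lra.
have [d1 d10 hd1] := pow_deriv Zy cq' e40.
have [d2 d20 hd2] := df _ _ cq' e40.
exists (Num.min d1 d2); first by rewrite lt_min d10.
move=> v /andP[v0 vb]; rewrite lt_min => /andP[vd1 vd2].
have vl : 0 <= v < l by rewrite v0 (le_lt_trans vb).
have := hd2 v vl vd2; have := vd1; case: (ltgtP v s) => [vs|vs|->].
(* For [v < s] the increment of [f] is hit by [m] more steps than the increment of the powers, so
   [F(h)^m y - y] must be estimated as well. *)
- rewrite ltr0_norm ?subr_lt0// opprB => sd fv.
  near=> h.
  have h0 : 0 < h by near: h; exact: nbhs_right_gt.
  have bs : 0 <= b - s by lra.
  have bv : 0 <= b - v by lra.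
  have [|m mE] := truncn_increment h0 bs (_ : _ <= b - v); first lra.
  rewrite (_ : b - v - (b - s) = s - v); last by lra.
  move: mE; set K := Num.truncn ((b - s) / h) => mE mh.
  have Kb : K%:R * h <= b by have := truncn_mul_le h0 bs; rewrite -/K; lra.
  have Kmb : (K + m)%:R * h <= b by have := truncn_mul_le h0 bv; rewrite mE; lra.
  have [gx gy] : q' (iter m (F h) (f s) - f s - of_real k (s - v) *: y)
      <= e / 4 * (s - v) /\ q' (iter m (F h) y - y) <= e / 4.
    move: m mh {mE Kmb}; near: h; apply: hd1; lra.
  have -> : iter (Num.truncn ((b - v) / h)) (F h) (f v) - iter K (F h) (f s) =
      iter (K + m) (F h) (f v - f s - of_real k (v - s) *: y)
      + (iter K (F h) (iter m (F h) (f s) - f s - of_real k (s - v) *: y)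
         - iter K (F h) (of_real k (s - v) *: (iter m (F h) y - y))).
    have h0' := ltW h0.
    rewrite mE !iterD -!powB// -powD//; congr (iter K (F h) _).
    rewrite -(opprB s v) rmorphN scaleNr opprK powD// powB// powZ//.
    by rewrite scalerBr opprB subrKA addrACA subrr addr0 subrKA.
  have b1 := le_trans (hq' _ _ (f v - f s - of_real k (v - s) *: y) h0 Kmb) fv.
  have b2 := le_trans (hq' _ _ _ h0 Kb) gx.
  have b3 : q (iter K (F h) (of_real k (s - v) *: (iter m (F h) y - y)))
      <= e / 4 * (s - v).
    apply: le_trans (hq' _ _ _ h0 Kb) _.
    by rewrite (seminormZ cq'.1) gtr0_norm ?subr_gt0// mulrC ler_pM2r ?subr_gt0.
  have esv : 0 < e * (s - v) by rewrite mulr_gt0// subr_gt0.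
  apply: le_trans (cq.1.1 _ _) _; apply: le_trans (lerD b1 (cq.1.1 _ _)) _.
  by rewrite (seminormN cq.1); lra.
- rewrite gtr0_norm ?subr_gt0// => sd fv.
  near=> h.
  have h0 : 0 < h by near: h; exact: nbhs_right_gt.
  have bs : 0 <= b - s by lra.
  have bv : 0 <= b - v by lra.
  have [|m mE] := truncn_increment h0 bv (_ : _ <= b - s); first lra.
  rewrite (_ : b - s - (b - v) = v - s); last by lra.
  move: mE; set K := Num.truncn ((b - v) / h) => mE mh.
  have Kb : K%:R * h <= b by have := truncn_mul_le h0 bv; rewrite -/K; lra.
  have [gx _] : q' (iter m (F h) (f s) - f s - of_real k (v - s) *: y)
      <= e / 4 * (v - s) /\ q' (iter m (F h) y - y) <= e / 4.
    move: m mh {mE}; near: h; apply: hd1; lra.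
  have -> : iter K (F h) (f v) - iter (Num.truncn ((b - s) / h)) (F h) (f s) =
      iter K (F h) (f v - f s - of_real k (v - s) *: y)
      - iter K (F h) (iter m (F h) (f s) - f s - of_real k (v - s) *: y).
    rewrite mE !iterD -!powB ?(ltW h0)//; congr (iter K (F h) _).
    by rewrite opprB addrA subrK opprB addrA subrK.
  have b1 := le_trans (hq' _ _ _ h0 Kb) fv.
  have b2 := le_trans (hq' _ _ _ h0 Kb) gx.
  have esv : 0 < e * (v - s) by rewrite mulr_gt0// subr_gt0.
  apply: le_trans (cq.1.1 _ _) _.
  by rewrite (seminormN cq.1); lra.
- by move=> _ _; near=> h; rewrite !subrr normr0 mulr0 (seminorm0 cq.1).
Unshelve. all: by end_near. Qed.

(** By real induction the drift of [F(h)^[(b - v)/h] (f v)] from its value at [v = 0] is at most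
    [c * v]; at [v = b] no step is left and [f b] remains. *)
Lemma pow_cvg_solution b q e : 0 <= b < l -> csn q -> 0 < e ->
  \forall h \near 0^'+, q (iter (Num.truncn (b / h)) (F h) x0 - f b) <= e.
Proof.
move=> /andP[b0 bl] cq e0.
(* Dividing by [b + 1] gives [c * b <= e] and also covers [b = 0]. *)
pose c := e / (b + 1).
have c0 : 0 < c by rewrite divr_gt0//; lra.
have cb : c * (b + 1) = e by rewrite divfK// gt_eqF//; lra.
suff : \forall h \near 0^'+,
    q (iter (Num.truncn ((b - b) / h)) (F h) (f b)
       - iter (Num.truncn (b / h)) (F h) x0) <= c * b.
  apply: filterS => h; rewrite subrr mul0r truncn0/= (seminormC cq.1).
  by move=> /le_trans; apply; rewrite -cb; lra.
apply: (real_induction (P := fun v => \forall h \near 0^'+,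
    q (iter (Num.truncn ((b - v) / h)) (F h) (f v)
       - iter (Num.truncn (b / h)) (F h) x0) <= c * v)) => //.
  by near=> h; rewrite subr0 solf.1 subrr (seminorm0 cq.1) mulr0.
move=> s sb; have [d d0 hd] := pow_solution_increment sb bl cq c0.
exists d => // v w /andP[v0 vs] /andP[sw wb] dv wd Pv; move/andP: (sb) => [s0 sb'].
near=> h.
have b1 : q (iter (Num.truncn ((b - v) / h)) (F h) (f v)
    - iter (Num.truncn ((b - s) / h)) (F h) (f s)) <= c * `|v - s|.
  near: h; apply: hd; first by rewrite v0 (le_trans vs).
  by rewrite ler0_norm; lra.
have b2 : q (iter (Num.truncn ((b - w) / h)) (F h) (f w)
    - iter (Num.truncn ((b - s) / h)) (F h) (f s)) <= c * `|w - s|.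
  near: h; apply: hd; first by rewrite wb (le_trans s0).
  by rewrite ger0_norm; lra.
have b3 : q (iter (Num.truncn ((b - v) / h)) (F h) (f v)
   - iter (Num.truncn (b / h)) (F h) x0) <= c * v by near: h.
move: b1 b2; rewrite ler0_norm ?subr_le0// ger0_norm ?subr_ge0// => b1 b2.
(* Passing from [v] to [w] through [s] adds [c (s - v) + c (w - s)] to the drift [c v], which makes
   [c w]. *)
apply: le_trans (seminorm_triangle cq.1
  (iter (Num.truncn ((b - s) / h)) (F h) (f s)) _ _) _.
apply: le_trans (lerD (lexx _) (seminorm_triangle cq.1
  (iter (Num.truncn ((b - v) / h)) (F h) (f v)) _ _)) _.
by move: b1; rewrite (seminormC cq.1); nra.
Unshelve. all: by end_near. Qed.

End LocalSolution.

(** * Limits of powers along a sequence of step sizes *)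

Lemma pow_uniform_continuity x b q e : 0 <= b -> csn q -> 0 < e ->
  exists2 d : R, 0 < d & forall s r, 0 <= s -> s <= r -> r <= b -> r - s < d ->
    \forall h \near 0^'+,
      q (iter (Num.truncn (r / h)) (F h) x - iter (Num.truncn (s / h)) (F h) x) <= e.
Proof.
move=> b0 cq e0; have [q' cq' [_ hq']] := pow_equicontinuous b0 cq.
have [d d0 hd] := pow_near_id x cq' e0.
exists (d / 2); first by lra.
move=> s r s0 sr rb rsd; near=> h.
have /andP[h0 h1] : 0 < h < d / 2 by near: h; apply: near_right_lt; lra.
have [m mE mh] := truncn_increment h0 s0 sr.
(* The common factor [F(h)^[s/h]] is absorbed by [q'], so [d] depends on neither [s] nor [r]. *)
rewrite mE iterD -powB ?(ltW h0)//.
apply: le_trans (hq' _ _ _ h0 _) _.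
  by apply: le_trans (truncn_mul_le h0 s0) _; exact: (le_trans sr rb).
have : m%:R * h <= d by move: mh; rewrite ler_norml; lra.
by move: m {mE mh}; near: h.
Unshelve. all: by end_near. Qed.

(** Take a rational [r] slightly to the right of [s]. By uniform continuity the sequence at [s]
    finally stays within [e / 2] of the limit at [r]. *)
Lemma pow_cauchy (tau : nat -> R) (l : R) x : tau @ \oo --> 0^'+ ->
  (forall r : rat, 0 <= (ratr r : R) < l -> exists z : X,
    (fun n => iter (Num.truncn (ratr r / tau n)) (F (tau n)) x) @ \oo --> z) ->
  forall s, 0 <= s < l ->
    tvs_cauchy_seq (fun n => iter (Num.truncn (s / tau n)) (F (tau n)) x).
Proof.
move=> tau_cvg cvgQ s /andP[s0 sl]; apply/(cvg_csnP hp) => q e cq e0.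
have e40 : 0 < e / 4 by lra.
have [d d0 hd] := pow_uniform_continuity x (le_trans s0 (ltW sl)) cq e40.
have sm : s < Num.min l (s + d) by rewrite lt_min sl ltrDl.
have [r] := rat_in_itvoo sm; rewrite in_itv/= lt_min => /and3P[sr rl rd].
have [|z /(cvg_csnP hp)/(_ q _ cq e40) Uz] := cvgQ r.
  by rewrite rl (le_trans s0 (ltW sr)).
have rsd : ratr r - s < d by lra.
have hs := tau_cvg _ (hd s (ratr r) s0 (ltW sr) (ltW rl) rsd).
have near_z : \forall n \near \oo,
    q (iter (Num.truncn (s / tau n)) (F (tau n)) x - z) < e / 2.
  near=> n.
  have b1 : q (iter (Num.truncn (ratr r / tau n)) (F (tau n)) x
      - iter (Num.truncn (s / tau n)) (F (tau n)) x) <= e / 4 by near: n.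
  have b2 : q (iter (Num.truncn (ratr r / tau n)) (F (tau n)) x - z) < e / 4 by near: n.
  have := seminorm_triangle cq.1 (iter (Num.truncn (ratr r / tau n)) (F (tau n)) x)
    (iter (Num.truncn (s / tau n)) (F (tau n)) x) z.
  by move: b1; rewrite (seminormC cq.1); lra.
exists ([set n | q (iter (Num.truncn (s / tau n)) (F (tau n)) x - z) < e / 2],
        [set n | q (iter (Num.truncn (s / tau n)) (F (tau n)) x - z) < e / 2]) => //=.
move=> [m n] /= [hm hn]; rewrite subr0.
apply: le_lt_trans (seminorm_triangle cq.1 z _ _) _.
by rewrite (seminormC cq.1 z); lra.
Unshelve. all: by end_near. Qed.

Section LimitSolution.
Variables (tau : nat -> R) (l : R) (x0 w : X) (f : R -> X).
Hypothesis tau_cvg : tau @ \oo --> 0^'+.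
Hypothesis Zx0 : closure A (x0, w).
Local Notation U := (fun (s : R) n =>
  iter (Num.truncn (s / tau n)) (F (tau n)) x0).
Hypothesis U_cvg : forall s, 0 <= s < l -> U s @ \oo --> f s.

Let near_tau (P : set R) : (\forall h \near 0^'+, P h) -> \forall n \near \oo, P (tau n).
Proof. exact: tau_cvg. Qed.

Let tau_small (e : R) : 0 < e -> \forall n \near \oo, 0 < tau n < e.
Proof. by move=> e0; exact: near_tau (near_right_lt e0). Qed.

(** With [K = [s / tau n]], the powers commute: [F^K (F^m x0 - x0) = F^m (F^K x0) - F^K x0]. The key
    estimate at [x0] makes the left side about [r F^K w]; since [F^K x0] tends to [f s], the one at
    [f s] makes the right side about [r y]. Then [r] is divided out. *)
Lemma pow_image_cvg s y q e : 0 <= s < l -> closure A (f s, y) ->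
  csn q -> 0 < e -> \forall n \near \oo,
  q (iter (Num.truncn (s / tau n)) (F (tau n)) w - y) <= e.
Proof.
move=> sl Zy cq e0; have /andP[s0 _] := sl.
(* This span covers the [K] steps up to time [s] and the [m] steps up to [r + tau n < 2]. *)
have c0 : 0 <= s + 2 by lra.
have [q' cq' [qq' hq']] := pow_equicontinuous c0 cq.
have e40 : 0 < e / 4 by lra.
have [d1 d10 hd1] := pow_deriv Zx0 cq' e40.
have [d2 d20 hd2] := pow_deriv Zy cq' e40.
pose d := Num.min d1 (Num.min d2 1).
have d0 : 0 < d by rewrite !lt_min d10 d20 ltr01.
have [dd1 dd2 dd3] : [/\ d <= d1, d <= d2 & d <= 1].
  by split; rewrite !ge_min lexx ?orbT.
pose r := d / 2; have r0 : 0 < r by rewrite /r; lra.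
have er0 : 0 < e / 4 * r by rewrite mulr_gt0.
have r1 : 0 < r < d1 by rewrite /r; lra.
have r2 : 0 < r < d2 by rewrite /r; lra.
near=> n.
have /andP[h0 h1] : 0 < tau n < 1 by near: n; exact: tau_small.
(* The factor [r] anticipates the final division by [r]. *)
have Ufs : q' (U s n - f s) < e / 4 * r.
  by near: n; exact: ((cvg_csnP hp _ _).1 (U_cvg sl) _ _ cq' er0).
have [m _] := truncn_increment h0 (lexx 0) (ltW r0); rewrite subr0 => mr.
have gx : q' (iter m (F (tau n)) x0 - x0 - of_real k r *: w) <= e / 4 * r.
  have : forall m, `|m%:R * tau n - r| <= tau n ->
    q' (iter m (F (tau n)) x0 - x0 - of_real k r *: w) <= e / 4 * r /\
    q' (iter m (F (tau n)) w - w) <= e / 4.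
    near: n; exact: near_tau (hd1 r r1).
  by case/(_ m mr).
have gy : q' (iter m (F (tau n)) (f s) - f s - of_real k r *: y) <= e / 4 * r.
  have : forall m, `|m%:R * tau n - r| <= tau n ->
    q' (iter m (F (tau n)) (f s) - f s - of_real k r *: y) <= e / 4 * r /\
    q' (iter m (F (tau n)) y - y) <= e / 4.
    near: n; exact: near_tau (hd2 r r2).
  by case/(_ m mr).
have ms : m%:R * tau n <= s + 2 by move: mr; rewrite ler_norml /r; lra.
have Ks : (Num.truncn (s / tau n))%:R * tau n <= s + 2.
  by have := truncn_mul_le h0 s0; lra.
set K := Num.truncn (s / tau n) in Ks *.
have E : of_real k r *: (iter K (F (tau n)) w - y) =
    (iter m (F (tau n)) (f s) - f s - of_real k r *: y)
    + iter m (F (tau n)) (U s n - f s) - (U s n - f s)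
    - iter K (F (tau n)) (iter m (F (tau n)) x0 - x0 - of_real k r *: w).
  have h0' := ltW h0.
  rewrite /= (powB m)// !(powB K)// (powZ K)// -/K -!iterD (addnC m K).
  rewrite scalerBr !opprB !addrA (ACl (1*5*2*6*4*10*7*9*8*3)).
  by rewrite /= subrr add0r addNr add0r subrr add0r addNr add0r.
have b1 := le_trans (qq' _) gy.
have b2 := le_trans (hq' _ _ _ h0 ms) (ltW Ufs).
have b3 := le_trans (qq' _) (ltW Ufs).
have b4 := le_trans (hq' _ _ _ h0 Ks) gx.
rewrite -(ler_pM2l r0) -{1}(gtr0_norm r0) -(seminormZ cq.1) E.
apply: le_trans (cq.1.1 _ _) _.
apply: le_trans (lerD (cq.1.1 _ _) (lexx _)) _.
apply: le_trans (lerD (lerD (cq.1.1 _ _) (lexx _)) (lexx _)) _.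
rewrite !(seminormN cq.1) [leRHS]mulrC; move: b1 b2 b3 b4; rewrite -/K.
lra.
Unshelve. all: by end_near. Qed.

(** An increment of [f] is the limit of an increment of the powers, which the key estimate at
    [(x0, w)] turns into [v - s] times a power applied to [w]; that power of [w] tends to the image
    of [f s]. *)
Lemma limit_local_solution : hausdorff_space X -> 0 < l ->
  (forall s, 0 <= s < l -> domain (closure A) (f s)) ->
  local_solution (closure A) l x0 f.
Proof.
move=> hausX l0 domf; split.
  have l00 : 0 <= (0 : R) < l by rewrite lexx.
  have U0 : U 0 = fun=> x0 by apply/funext => n; rewrite mul0r truncn0.
  by have := U_cvg l00; rewrite U0 => /(cvg_unique hausX); apply; exact: cvg_cst.
move=> s sl; have [y Zy] := domf s sl; exists y; split=> //.
apply/(difference_quotient_csnP hp) => q e cq e0.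
have [q' cq' [_ hq']] := pow_equicontinuous (ltW l0) cq.
have e60 : 0 < e / 6 by lra.
have [d d0 hd] := pow_deriv Zx0 cq' e60.
exists d => // v vl.
have Uq := fun v vl => (cvg_csnP hp _ _).1 (U_cvg vl) q.
move/andP: (sl) => [s0 s1]; move/andP: (vl) => [v0 v1].
have Kl v' h : 0 <= v' < l -> 0 < h -> (Num.truncn (v' / h))%:R * h <= l.
  move=> /andP[v'0 v'l] h0; exact: le_trans (truncn_mul_le h0 v'0) (ltW v'l).
case: (ltgtP v s) => [vs|vs|->].
(* Here the increment starts at the earlier time [v] and produces [F^K w], whereas convergence to
   [y] is known for [F^(K + m) w]; [g2] bridges the two. *)
- rewrite ltr0_norm ?subr_lt0// opprB => sd.
  have r0 : 0 < s - v by rewrite subr_gt0.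
  have rd : 0 < s - v < d by rewrite r0.
  have er0 : 0 < e / 6 * (s - v) by exact: mulr_gt0.
  (* The index is chosen after [v], so the errors of [U] can be made small relative to [|v - s|]. *)
  near \oo => n.
  have /andP[h0 h1] : 0 < tau n < 1 by near: n; exact: tau_small ltr01.
  have b1 : q (U s n - f s) < e / 6 * (s - v) by near: n; exact: Uq.
  have b2 : q (U v n - f v) < e / 6 * (s - v) by near: n; exact: Uq.
  have b3 : q (iter (Num.truncn (s / tau n)) (F (tau n)) w - y) <= e / 6.
    by near: n; exact: pow_image_cvg.
  have [m mE mr] := truncn_increment h0 v0 (ltW vs).
  have [g1 g2] : q' (iter m (F (tau n)) x0 - x0 - of_real k (s - v) *: w)
      <= e / 6 * (s - v) /\ q' (iter m (F (tau n)) w - w) <= e / 6.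
    by move: m mr {mE}; near: n; exact: near_tau (hd _ rd).
  have {}g1 := le_trans (hq' _ _ _ h0 (Kl _ _ vl h0)) g1.
  have {}g2 := le_trans (hq' _ _ _ h0 (Kl _ _ vl h0)) g2.
  move: b1 b2 b3 g1 g2; rewrite mE /=; set K := Num.truncn (v / tau n) => b1 b2 b3 g1 g2.
  have -> : f v - f s - of_real k (v - s) *: y =
    (U s n - f s) - (U v n - f v)
    - iter K (F (tau n)) (iter m (F (tau n)) x0 - x0 - of_real k (s - v) *: w)
    + of_real k (s - v) *: iter K (F (tau n)) (iter m (F (tau n)) w - w)
    - of_real k (s - v) *: (iter (K + m) (F (tau n)) w - y).
    have h0' := ltW h0.
    rewrite /= mE -/K -(opprB s v) rmorphN scaleNr opprK.
    rewrite !(powB K)// (powZ K)// -!iterD !scalerBr !opprB !addrA.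
    rewrite [RHS](ACl (1*7*4*6*5*9*8*11*3*2*10))/=.
    by rewrite subrr add0r addNr add0r subrr add0r subrr add0r.
  apply: le_trans (cq.1.1 _ _) _.
  apply: le_trans (lerD (cq.1.1 _ _) (lexx _)) _.
  apply: le_trans (lerD (lerD (cq.1.1 _ _) (lexx _)) (lexx _)) _.
  apply: le_trans (lerD (lerD (lerD (cq.1.1 _ _) (lexx _)) (lexx _)) (lexx _)) _.
  rewrite !(seminormN cq.1) !(seminormZ cq.1) gtr0_norm//=.
  rewrite -(ler_pM2l r0) in b3; rewrite -(ler_pM2l r0) in g2.
  rewrite mE -/K; lra.
- rewrite gtr0_norm ?subr_gt0// => sd.
  have r0 : 0 < v - s by rewrite subr_gt0.
  have rd : 0 < v - s < d by rewrite r0.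
  have er0 : 0 < e / 6 * (v - s) by exact: mulr_gt0.
  near \oo => n.
  have /andP[h0 h1] : 0 < tau n < 1 by near: n; exact: tau_small ltr01.
  have b1 : q (U s n - f s) < e / 6 * (v - s) by near: n; exact: Uq.
  have b2 : q (U v n - f v) < e / 6 * (v - s) by near: n; exact: Uq.
  have b3 : q (iter (Num.truncn (s / tau n)) (F (tau n)) w - y) <= e / 6.
    by near: n; exact: pow_image_cvg.
  have [m mE mr] := truncn_increment h0 s0 (ltW vs).
  have [g1 _] : q' (iter m (F (tau n)) x0 - x0 - of_real k (v - s) *: w)
      <= e / 6 * (v - s) /\ q' (iter m (F (tau n)) w - w) <= e / 6.
    by move: m mr {mE}; near: n; exact: near_tau (hd _ rd).
  have {}g1 := le_trans (hq' _ _ _ h0 (Kl _ _ sl h0)) g1.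
  move: b1 b2 b3 g1; rewrite mE /=; set K := Num.truncn (s / tau n) => b1 b2 b3 g1.
  have -> : f v - f s - of_real k (v - s) *: y =
    (U s n - f s) - (U v n - f v)
    + iter K (F (tau n)) (iter m (F (tau n)) x0 - x0 - of_real k (v - s) *: w)
    + of_real k (v - s) *: (iter K (F (tau n)) w - y).
    have h0' := ltW h0.
    rewrite /= mE -/K.
    rewrite !(powB K)// (powZ K)// -!iterD !scalerBr !opprB !addrA.
    rewrite [RHS](ACl (1*6*4*5*7*8*3*2*9))/=.
    by rewrite subrr add0r addNr add0r addNr add0r.
  apply: le_trans (cq.1.1 _ _) _.
  apply: le_trans (lerD (cq.1.1 _ _) (lexx _)) _.
  apply: le_trans (lerD (lerD (cq.1.1 _ _) (lexx _)) (lexx _)) _.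
  rewrite !(seminormN cq.1) !(seminormZ cq.1) gtr0_norm//=.
  rewrite -(ler_pM2l r0) in b3.
  rewrite mE -/K; lra.
- by move=> _; rewrite !subrr rmorph0 scale0r subrr (seminorm0 cq.1) normr0 mulr0.
Unshelve. all: by end_near. Qed.

End LimitSolution.

End Chernoff.

(** * Diagonal extraction of a subsequence *)

Section DiagonalSubsequence.
Variables (T : topologicalType) (u : nat -> nat -> T).
Hypothesis usub : forall i, subsequences_have_cvg_subsequence (u i).

Let incr (phi : nat -> nat) := {homo phi : m n / (m < n)%N}.

Lemma incr_ge phi n : incr phi -> (n <= phi n)%N.
Proof.
move=> iphi; elim: n => // n IH.
by apply: leq_ltn_trans IH _; exact: iphi.
Qed.

Lemma incr_cvg phi : incr phi -> phi @ \oo --> \oo.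
Proof.
move=> iphi P [N _ NP]; exists N => // n /= Nn.
by apply: NP; exact: leq_trans Nn (incr_ge n iphi).
Qed.

Lemma diagonal_subsequence : exists2 phi, incr phi &
  forall i, exists x : T, u i \o phi @ \oo --> x.
Proof.
(* The refinement is made a total function by choice; on maps that are not increasing its value is
   irrelevant. *)
have [sel selP] : {sel : nat -> (nat -> nat) -> (nat -> nat) |
    forall i phi, incr phi -> incr (sel i phi) /\
      exists x : T, u i \o phi \o sel i phi @ \oo --> x}.
  have H (c : nat * (nat -> nat)) : exists psi, incr c.2 ->
      incr psi /\ exists x : T, u c.1 \o c.2 \o psi @ \oo --> x.
    have [ic|nic] := pselect (incr c.2); last by exists id.
    by have [psi ipsi xpsi] := usub c.1 ic; exists psi.
  have [g gP] := choice H.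
  by exists (fun i phi => g (i, phi)) => i phi /(gP (i, phi)).
pose nest := fix nest n := if n is n'.+1 then nest n' \o sel n' (nest n') else id.
have inest n : incr (nest n).
  elim: n => [|n IH] m1 m2 m12; first by [].
  by apply: (IH); apply: (selP n _ IH).1.
have nestD i j : exists2 theta, incr theta & nest (i + j)%N = nest i \o theta.
  elim: j => [|j [theta itheta E]]; first by exists id; rewrite ?addn0.
  exists (theta \o sel (i + j)%N (nest (i + j)%N)).
    by move=> m1 m2 m12; apply: itheta; exact: (selP _ _ (inest _)).1.
  by rewrite addnS /= E.
exists (fun n => nest n n).
  have step n : (nest n n < nest n.+1 n.+1)%N.
    apply: (inest n); exact: (incr_ge n.+1 (selP n _ (inest n)).1).
  by apply: homo_ltn => // ? ? ?; exact: ltn_trans.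
move=> i; have [_ [x ux]] := selP i _ (inest i); exists x => P /ux[N _ NP].
(* From [i.+1] on, the diagonal runs inside [nest i.+1], along which [u i] converges, at positions
   [theta n >= n]. *)
exists (maxn N i.+1) => // n /=; rewrite geq_max => /andP[Nn iin].
have [theta itheta E] := nestD i.+1 (n - i.+1)%N.
move: E; rewrite subnKC// => ->.
by apply: (NP (theta n)); apply: leq_trans Nn (incr_ge _ itheta).
Qed.

End DiagonalSubsequence.

(** * Weak closedness of closed subspaces *)

Section ScalarNorm.
Variables (R : realType) (k : scalar_kind).

Lemma of_real_norm (a : scalar_field R k) : exists2 r : R, 0 <= r & `|a| = of_real k r.
Proof.
case: k a => a; first by exists `|a|.
have := normr_ge0 a; case: `|a| => b c /=; rewrite lecE/= => /andP[/eqP-> b0].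
by exists b.
Qed.

End ScalarNorm.

(* The complex-linear extension of [L] is [L v - i L (i v)]. *)
Lemma complex_functional (R : realType) (V : lmodType R[i]) (L : V -> R) :
  {morph L : x y / x + y} -> (forall r x, L (r%:C%C *: x) = r * L x) ->
  exists phi : V -> R[i],
    [/\ forall a x y, phi (a *: x + y) = a * phi x + phi y,
        forall v, phi v = 0 -> L v = 0 &
        forall v, `|phi v| <= (`|L v| + `|L ('i%C *: v)|)%:C%C].
Proof.
move=> LD LZ.
have LZi (a b : R) v : L ((a +i* b)%C *: v) = a * L v + b * L ('i%C *: v).
  rewrite -(LZ a) -(LZ b) -LD scalerA -scalerDl; congr (L (_ *: _)).
  by rewrite {1}[(a +i* b)%C]complexE mulrC.
have LZii (a b : R) v : L ('i%C *: ((a +i* b)%C *: v)) = - b * L v + a * L ('i%C *: v).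
  rewrite scalerA -LZi; congr (L (_ *: _)).
  by apply/eqP; rewrite eq_complex /=; apply/andP; split; apply/eqP; ring.
exists (fun v => (L v +i* - L ('i%C *: v))%C); split=> [[a b] x y|v [//]|v].
  rewrite scalerDr !LD LZii LZi.
  by apply/eqP; rewrite eq_complex /=; apply/andP; split; apply/eqP; ring.
rewrite normc_def lecR /= sqrrN.
have [h1 h2] := (normr_ge0 (L v), normr_ge0 (L ('i%C *: v))).
rewrite -[leRHS]ger0_norm ?addr_ge0// -sqrtr_sqr ler_wsqrtr//.
by rewrite sqrrD !real_normK ?num_real// lerD2r lerDl mulrn_wge0// mulr_ge0.
Qed.


(** The scalar [j] is 0 over the reals and the imaginary unit over the complex numbers, which gives
    both cases the same bound. *)
Lemma scalar_functional (R : realType) (k : scalar_kind)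
    (V : lmodType (scalar_field R k)) (L : V -> R) :
  {morph L : x y / x + y} -> (forall r x, L (of_real k r *: x) = r * L x) ->
  exists (phi : V -> scalar_field R k) (j : scalar_field R k),
    [/\ forall a x y, phi (a *: x + y) = a * phi x + phi y,
        forall v, phi v = 0 -> L v = 0 &
        forall v, `|phi v| <= of_real k (`|L v| + `|L (j *: v)|)].
Proof.
case: k V L => V L LD LZ.
  by exists L, 0; split=> // [a x y|v]; [rewrite LD LZ|rewrite lerDl].
have [phi [? ? ?]] := @complex_functional R V L LD LZ.
by exists phi, 'i%C.
Qed.

Section DistanceSeminorm.
Variables (R : realType) (k : scalar_kind) (V : lmodType (scalar_field R k)).
Variables (Q : V -> R) (S : set V).
Hypothesis QD : forall v w, Q (v + w) <= Q v + Q w.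
Hypothesis QZ : forall (a : scalar_field R k) v, of_real k (Q (a *: v)) = `|a| * of_real k (Q v).
Hypothesis S0 : S 0.
Hypothesis SZ : forall (a : scalar_field R k) v w, S v -> S w -> S (a *: v + w).

(** The pullback to [V] of the quotient seminorm on [V / S]. *)
Definition dist_seminorm v := inf [set Q (v - w) | w in S].

Lemma QZ_real a r v : `|a| = of_real k r -> Q (a *: v) = r * Q v.
Proof.
by move=> ar; apply: (@of_real_inj R k); rewrite QZ ar -rmorphM.
Qed.

Let QN v : Q (- v) = Q v.
Proof. by rewrite -scaleN1r (@QZ_real _ 1) ?mul1r// normrN1 rmorph1. Qed.

Let Q_ge0 v : 0 <= Q v.
Proof.
have := QD v (- v); rewrite subrr QN -(scale0r (0 : V)).
by rewrite (@QZ_real _ 0) ?normr0 ?rmorph0// mul0r => ?; lra.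
Qed.

Let has_inf_dist v : has_inf [set Q (v - w) | w in S].
Proof.
split; first by exists (Q (v - 0)), 0.
by exists 0 => _ [w _ <-].
Qed.

Lemma dist_seminorm_le v w : S w -> dist_seminorm v <= Q (v - w).
Proof. by move=> Sw; apply: ge_inf; [exact: (has_inf_dist v).2|exists w]. Qed.

Lemma dist_seminorm_ge e v : (forall w, S w -> e <= Q (v - w)) -> e <= dist_seminorm v.
Proof.
move=> h; apply: lb_le_inf; first exact: (has_inf_dist v).1.
by move=> _ [w Sw <-]; exact: h.
Qed.

Lemma dist_seminorm_ge0 v : 0 <= dist_seminorm v.
Proof. by apply: dist_seminorm_ge. Qed.

Lemma dist_seminormD v w : dist_seminorm (v + w) <= dist_seminorm v + dist_seminorm w.
Proof.
apply/ler_addgt0Pr => e e0; have e20 : 0 < e / 2 by lra.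
have [_ [v' Sv <-] hv] := inf_adherent e20 (has_inf_dist v).
have [_ [w' Sw <-] hw] := inf_adherent e20 (has_inf_dist w).
have Svw : S (v' + w') by rewrite -[v']scale1r; exact: SZ.
have := dist_seminorm_le (v + w) Svw.
rewrite opprD addrACA; have := QD (v - v') (w - w').
by move: hv hw; rewrite -/(dist_seminorm v) -/(dist_seminorm w); lra.
Qed.

Lemma dist_seminormZ a r v : `|a| = of_real k r ->
  dist_seminorm (a *: v) = r * dist_seminorm v.
Proof.
(* One inequality for all scalars suffices; the reverse follows by applying it to [a^-1]. *)
have le b t u : `|b| = of_real k t -> dist_seminorm (b *: u) <= t * dist_seminorm u.
  move=> bt.
  have t0 : 0 <= t by rewrite -(ler_of_real k) rmorph0 -bt.
  move: t0; rewrite le_eqVlt => /predU1P[t0|t0].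
    move: bt; rewrite -t0 rmorph0 mul0r => /normr0_eq0->; rewrite scale0r.
    apply: le_trans (dist_seminorm_le _ S0) _; rewrite subr0 -(scale0r (0 : V)).
    by rewrite (@QZ_real _ 0) ?mul0r// normr0 rmorph0.
  rewrite -ler_pdivrMl//; apply: dist_seminorm_ge => w Sw; rewrite ler_pdivrMl//.
  rewrite -(QZ_real _ bt) scalerBr; apply: dist_seminorm_le.
  by rewrite -[_ *: _]addr0; exact: SZ.
move=> ar; have [a0|a0] := eqVneq a 0.
  have r0 : r = 0 by apply: (@of_real_inj R k); rewrite -ar a0 normr0 rmorph0.
  apply/eqP; rewrite eq_le le//= r0 mul0r; exact: dist_seminorm_ge0.
have r0 : r != 0 by apply: contra_neq a0 => r0; apply/normr0_eq0; rewrite ar r0 rmorph0.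
have r_gt0 : 0 < r by rewrite lt_neqAle eq_sym r0 -(ler_of_real k) rmorph0 -ar normr_ge0.
apply/eqP; rewrite eq_le le//=.
have := le a^-1 r^-1 (a *: v); rewrite normfV ar fmorphV => /(_ erefl).
by rewrite scalerA mulVf// scale1r ler_pdivlMl.
Qed.

Lemma dist_seminorm_sublinear :
  sublinear (@of_real R k : {rmorphism R -> scalar_field R k}) dist_seminorm.
Proof.
split=> [|r x r0]; first exact: dist_seminormD.
by apply: dist_seminormZ; rewrite norm_of_real ger0_norm.
Qed.

End DistanceSeminorm.

Section WeakClosure.
Context {R : realType} {k : scalar_kind} {X : tvsType (scalar_field R k)}.
Variables (Omega : Type) (p : Omega -> X -> R).
Hypothesis hp : generating_seminorms p.
Local Notation csn := (continuous_seminorm p).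

Lemma linear_csn_continuous (phi : X -> (scalar_field R k)^o) q :
  linear phi -> csn q -> (forall x, `|phi x : scalar_field R k| <= of_real k (q x)) ->
  continuous phi.
Proof.
move=> lphi cq phiq x; apply/cvgrPdist_lt => e e0.
have [d d0 de] := of_real_archi e0.
apply: filterS (nbhs_csn hp x cq d0) => y /= yd.
rewrite distrC; apply: lt_le_trans de.
have -> : phi y - phi x = phi (y - x).
  by rewrite -[in RHS]scaleN1r [y + _]addrC lphi scaleN1r addrC.
by apply: le_lt_trans (phiq _) _; rewrite ltr_of_real.
Qed.

(** Hahn-Banach applied to the distance from [S] gives a functional that vanishes on the closure,
    where the distance is zero, but not at [z]. Restricting it to the two axes of [X * X] gives
    [phi] and [psi]. *)
Lemma closed_subspace_separation (S : set (X * X)) z :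
  S 0 -> (forall (a : scalar_field R k) v w, S v -> S w -> S (a *: v + w)) ->
  ~ closure S z ->
  exists phi psi : @dual R k X,
    (forall w, closure S w -> sval phi w.1 + sval psi w.2 = 0) /\
    sval phi z.1 + sval psi z.2 != 0.
Proof.
move=> S0 SZ /(closure_csnP hp) nz.
have [q [e [cq e0 Hz]]] : exists q (e : R), [/\ csn q, 0 < e &
    forall w, S w -> e <= q (z.1 - w.1) + q (z.2 - w.2)].
  apply: contrapT => H; apply: nz => q e cq e0; apply: contrapT => H'; apply: H.
  exists q, e; split=> // w Sw; rewrite leNgt; apply/negP => lt; apply: H'.
  exists w; split=> //; apply: le_lt_trans lt; rewrite (seminormC cq.1).
    by rewrite lerDl (seminorm_ge0 cq.1).
  by rewrite lerDr (seminorm_ge0 cq.1).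
pose Q (v : X * X) := q v.1 + q v.2.
have QD v w : Q (v + w) <= Q v + Q w by rewrite /Q addrACA lerD// cq.1.1.
have QZ (a : scalar_field R k) v : of_real k (Q (a *: v)) = `|a| * of_real k (Q v).
  by rewrite /Q !rmorphD/= mulrDr !cq.1.2.
have [L [LD LZ Ld Lz]] := hahn_banach z (dist_seminorm_sublinear QD QZ S0 SZ).
set d := dist_seminorm Q S in Ld Lz.
have dZ a r v : `|a| = of_real k r -> d (a *: v) = r * d v.
  exact: dist_seminormZ QD QZ S0 SZ _ _ _.
have dN v : d (- v) = d v.
  by rewrite -scaleN1r (dZ _ 1) ?mul1r// normrN1 rmorph1.
have LN v : L (- v) = - L v.
  by rewrite -scaleN1r -(rmorph1 (of_real k)) -rmorphN LZ mulN1r.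
have Lnorm v : `|L v| <= d v.
  by rewrite ler_norml Ld andbT -lerN2 opprK -LN -(dN v) Ld.
have dQ v : d v <= Q v.
  by rewrite -[v in Q v]subr0; exact: (dist_seminorm_le QD QZ S0 v S0).
have [phi [j [lphi phi0 phij]]] := scalar_functional LD LZ.
have [r r0 jr] := of_real_norm j.
(* This bound yields both the continuity of [phi] and its vanishing on the closure of [S]. *)
have phid v : `|phi v| <= of_real k ((1 + r) * d v).
  apply: le_trans (phij v) _; rewrite ler_of_real mulrDl mul1r lerD//.
  by rewrite -(dZ _ _ _ jr).
have d_ge0 := dist_seminorm_ge0 QD QZ S0.
have phiQ v : `|phi v| <= of_real k ((1 + r) * Q v).
  by apply: le_trans (phid v) _; rewrite ler_of_real ler_wpM2l// addr_ge0.
have cq' : csn (fun x => (1 + r) * q x) by apply: csnZ => //; exact: addr_ge0.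
have lin1 : linear (fun x : X => phi (x, 0) : (scalar_field R k)^o).
  by move=> a x y; rewrite -[RHS]lphi; congr phi; apply/pair_equal_spec; rewrite /= scaler0 addr0.
have lin2 : linear (fun x : X => phi (0, x) : (scalar_field R k)^o).
  by move=> a x y; rewrite -[RHS]lphi; congr phi; apply/pair_equal_spec; rewrite /= scaler0 addr0.
have cont1 : continuous (fun x : X => phi (x, 0) : (scalar_field R k)^o).
  apply: (linear_csn_continuous lin1 cq') => x.
  by have := phiQ (x, 0); rewrite /Q/= (seminorm0 cq.1) addr0.
have cont2 : continuous (fun x : X => phi (0, x) : (scalar_field R k)^o).
  apply: (linear_csn_continuous lin2 cq') => x.
  by have := phiQ (0, x); rewrite /Q/= (seminorm0 cq.1) add0r.
pose to_dual g lg cg : @dual R k X := exist (fun g => linear g /\ continuous g) g (conj lg cg).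
exists (to_dual _ lin1 cont1), (to_dual _ lin2 cont2) => /=.
have phiE w : phi (w.1, 0) + phi (0, w.2) = phi w.
  rewrite -[phi (w.1, 0)]mul1r -lphi; congr phi.
  by case: w => w1 w2; apply/pair_equal_spec; rewrite /= !scale1r add0r addr0.
split=> [w Sw|]; rewrite phiE.
  have dw : d w = 0.
    apply/eqP; rewrite eq_le d_ge0 andbT; apply/ler_addgt0Pr => c c0.
    have c20 : 0 < c / 2 by lra.
    have [w' [Sw' w1 w2]] := (closure_csnP hp _ _).1 Sw q _ cq c20.
    apply: le_trans (dist_seminorm_le QD QZ S0 w Sw') _; rewrite add0r /Q/=.
    by rewrite (seminormC cq.1) (seminormC cq.1 w.2); lra.
  by apply/normr0_eq0/eqP; rewrite eq_le normr_ge0 andbT (le_trans (phid w))// dw mulr0 rmorph0.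
apply/eqP => /phi0; rewrite Lz => dz.
have : e <= d z by apply: (dist_seminorm_ge QD QZ S0) => w Sw; exact: Hz.
by rewrite dz; lra.
Qed.

(** A separating pair [phi], [psi] vanishes along the sequence, and this passes to the weak
    limits. *)
Lemma closed_subspace_weakly_closed (S : set (X * X)) (a b : nat -> X) x y :
  S 0 -> (forall (c : scalar_field R k) v w, S v -> S w -> S (c *: v + w)) ->
  (forall n, closure S (a n, b n)) -> weakly_cvg a x -> weakly_cvg b y ->
  closure S (x, y).
Proof.
move=> S0 SZ Sab /weakly_cvgP ax /weakly_cvgP bY; apply: contrapT => nS.
have [phi [psi [van /= nvan]]] := closed_subspace_separation S0 SZ nS.
move/eqP: nvan; apply.
have h : (fun n => sval phi (a n) + sval psi (b n)) @ \oo --> sval phi x + sval psi y.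
  exact: cvgD (ax phi) (bY psi).
have E : (fun n => sval phi (a n) + sval psi (b n)) = fun=> 0.
  by apply/funext => n; exact: (van (a n, b n)).
rewrite E in h.
exact: (cvg_unique (@norm_hausdorff _ (scalar_field R k)^o) h (cvg_cst _)).
Qed.

End WeakClosure.

(** * Generators and the Trotter product *)

Section Generators.
Context {R : realType} {k : scalar_kind} {X : tvsType (scalar_field R k)}.
Variables (Omega : Type) (p : Omega -> X -> R).
Hypothesis hp : generating_seminorms p.

Lemma generator0 (T : R -> X -> X) : equicontinuous_powers p T -> generator T 0.
Proof.
move=> eT; apply/(cvg_csnP hp) => q e [sq _] e0; near=> h.
have h0 : 0 <= h by apply: ltW; near: h; exact: nbhs_right_gt.
have T00 : T h 0 = 0 := pow0 eT 1 h0.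
by rewrite /= T00 !subrr scaler0 subrr (seminorm0 sq).
Unshelve. all: by end_near. Qed.

Lemma generatorP (T : R -> X -> X) : equicontinuous_powers p T ->
  forall (a : scalar_field R k) v w,
  generator T v -> generator T w -> generator T (a *: v + w).
Proof.
move=> eT a v w /(cvg_csnP hp) Tv /(cvg_csnP hp) Tw.
apply/(cvg_csnP hp) => q e cq e0.
have [r r0 ar] := of_real_norm a.
have e20 : 0 < e / 2 by lra.
have er0 : 0 < e / 2 / (r + 1) by rewrite divr_gt0//; lra.
near=> h.
have h0 : 0 <= h by apply: ltW; near: h; exact: nbhs_right_gt.
have b1 : q (of_real k h^-1 *: (T h v.1 - v.1) - v.2) < e / 2 / (r + 1).
  by near: h; exact: Tv.
have b2 : q (of_real k h^-1 *: (T h w.1 - w.1) - w.2) < e / 2.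
  by near: h; exact: Tw.
have TP : T h (a *: v.1 + w.1) = a *: T h v.1 + T h w.1 := pow_lin eT 1 h0 a v.1 w.1.
rewrite /= TP opprD addrACA -scalerBr scalerDr scalerA.
rewrite mulrC -scalerA opprD addrACA -scalerBr.
apply: le_lt_trans (cq.1.1 _ _) _.
have -> u : q (a *: u) = r * q u.
  by apply: (@of_real_inj R k); rewrite cq.1.2 ar -rmorphM.
move: b1; rewrite ltr_pdivlMr; last by lra.
have := seminorm_ge0 cq.1 (of_real k h^-1 *: (T h v.1 - v.1) - v.2); lra.
Unshelve. all: by end_near. Qed.

Lemma operator_sum0 (C D : set (X * X)) : C 0 -> D 0 -> operator_sum C D 0.
Proof. by move=> C0 D0; exists 0, 0; rewrite /= addr0. Qed.

Lemma operator_sumP (C D : set (X * X)) :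
  (forall (a : scalar_field R k) v w, C v -> C w -> C (a *: v + w)) ->
  (forall (a : scalar_field R k) v w, D v -> D w -> D (a *: v + w)) ->
  forall (a : scalar_field R k) v w, operator_sum C D v ->
    operator_sum C D w -> operator_sum C D (a *: v + w).
Proof.
move=> CP DP a v w [v1 [v2 [Cv Dv vE]]] [w1 [w2 [Cw Dw wE]]].
exists (a *: v1 + w1), (a *: v2 + w2); split.
- exact: CP Cv Cw.
- exact: DP Dv Dw.
- by rewrite /= vE wE scalerDr addrACA.
Qed.

Lemma dense_operator_sum (C D : set (X * X)) :
  dense (domain C `&` domain D) -> dense (domain (operator_sum C D)).
Proof.
move=> dCD O O0 oO; have [x [Ox [[y1 Cy] [y2 Dy]]]] := dCD O O0 oO.
by exists x; split=> //; exists (y1 + y2), y1, y2.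
Qed.

Lemma lC0_semigroup_cvg0 T x : lC0_semigroup p T -> T h x @[h --> 0^'+] --> x.
Proof.
move=> [cT T0 _ _].
have /subspace_continuousP/(_ 0) := cT x; rewrite /= in_itv/= lexx/=.
move=> /(_ erefl); rewrite /from_subspace/= T0 => T0x P /T0x.
rewrite /nbhs/= /within/=; apply: filterS => h Ph h0; apply: Ph.
by rewrite in_itv/= andbT ltW.
Qed.

(** The product rule: [C h (D h x) - x = C h (D h x - x) + (C h x - x)]. Equicontinuity of [C h] for
    [h <= 1] and its strong continuity at [y2] handle the first term. *)
Lemma trotter_deriv (C D : R -> X -> X) : lC0_semigroup p C -> lC0_semigroup p D ->
  forall x y, operator_sum (generator C) (generator D) (x, y) ->
  of_real k h^-1 *: ((C h \o D h) x - x) @[h --> 0^'+] --> y.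
Proof.
move=> sC sD x y [y1 [y2 /= [/(cvg_csnP hp)/= Cx /(cvg_csnP hp)/= Dx ->]]].
have [_ _ _ eC] := sC.
apply/(cvg_csnP hp) => q e cq e0.
have e30 : 0 < e / 3 by lra.
have [q' cq' [_ hq']] := pow_equicontinuous hp eC ler01 cq.
have /(cvg_csnP hp)/(_ _ _ cq e30) C2 := @lC0_semigroup_cvg0 C y2 sC.
near=> h.
have /andP[h0 h1] : 0 < h < 1 by near: h; exact: near_right_lt.
have b1 : q (of_real k h^-1 *: (C h x - x) - y1) < e / 3 by near: h; exact: Cx.
have b2 : q' (of_real k h^-1 *: (D h x - x) - y2) < e / 3 by near: h; exact: Dx.
have b3 : q (C h y2 - y2) < e / 3.
  by near: h; exact: C2.
have b4 : q (C h (of_real k h^-1 *: (D h x - x) - y2)) < e / 3.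
  by apply: le_lt_trans b2; apply: (hq' h 1%N) => //; rewrite mul1r ltW.
rewrite (_ : _ - _ = C h (of_real k h^-1 *: (D h x - x) - y2) + (C h y2 - y2)
  + (of_real k h^-1 *: (C h x - x) - y1)).
  apply: le_lt_trans (cq.1.1 _ _) _.
  by have := cq.1.1 (C h (of_real k h^-1 *: (D h x - x) - y2)) (C h y2 - y2); lra.
have h0' := ltW h0.
have CB u v : C h (u - v) = C h u - C h v := powB eC 1 u v h0'.
have CZ a u : C h (a *: u) = a *: C h u := powZ eC 1 a u h0'.
rewrite /= CB CZ CB.
rewrite subrKA addrACA -scalerDr subrKA (addrC y1) opprD //.
Unshelve. all: by end_near. Qed.

End Generators.

(** * Weak limits and the assembly of the equivalence *)

Lemma cvg_weakly_cvg (R : realType) (k : scalar_kind)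
    (X : tvsType (scalar_field R k)) (u : nat -> X) (x : X) :
  u @ \oo --> x -> weakly_cvg u x.
Proof.
move=> ux; apply/weakly_cvgP => phi.
by apply: continuous_cvg => //; exact: (svalP phi).2.
Qed.

Lemma cvg_subsequences (T : topologicalType) (u : nat -> T) (x : T) :
  u @ \oo --> x -> subsequences_have_cvg_subsequence u.
Proof.
move=> ux phi iphi; exists id => //; exists x.
exact: (@cvg_comp _ _ _ phi u _ _ _ (incr_cvg iphi) ux).
Qed.

Lemma weakly_cvgB (R : realType) (k : scalar_kind)
    (X : tvsType (scalar_field R k)) (u v : nat -> X) (x y : X) :
  weakly_cvg u x -> weakly_cvg v y -> weakly_cvg (fun n => u n - v n) (x - y).
Proof.
move=> /weakly_cvgP ux /weakly_cvgP vy; apply/weakly_cvgP => phi.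
have phiB a b : sval phi (a - b) = sval phi a - sval phi b.
  have [lphi _] := svalP phi.
  by rewrite -scaleN1r [a + _]addrC lphi scaleN1r addrC.
rewrite phiB; under eq_fun do rewrite phiB.
exact: cvgB (ux phi) (vy phi).
Qed.

Theorem corollary7p1 (R : realType) (k : scalar_kind)
  (X : tvsType (scalar_field R k)) (Omega : Type) (p : Omega -> X -> R)
  (hp : generating_seminorms p)
  (hausX : hausdorff_space X) (complX : sequentially_complete X)
  (t : R) (t_gt0 : 0 < t)
  (expC expD : R -> X -> X)
  (semigroupC : lC0_semigroup p expC) (semigroupD : lC0_semigroup p expD)
  (C D : set (X * X)) (genC : C = generator expC) (genD : D = generator expD)
  (hi : dense (domain C `&` domain D))
  (hii : equicontinuous_powers p (fun s : R => expC s \o expD s))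
  (l : R) (l_gt0 : 0 < l)
  (h : X) (hh : domain (closure (operator_sum C D)) h) :
  let Z := closure (operator_sum C D) in
  let F := fun s : R => expC s \o expD s in
  let u := fun (s : R) (n : nat) =>
    iter (Num.truncn (n.+1%:R * s)) (F (t / n.+1%:R)) h in
  let cond_a := forall s : R, 0 <= s < l / t ->
    subsequences_have_cvg_subsequence (u s) in
  let cond_b := forall s : R, 0 <= s < l / t ->
    exists f Zf : nat -> X,
      [/\ forall n, Z (f n, Zf n),
          weakly_cvg (fun n => u s n - f n) 0 &
          subsequences_have_cvg_subsequence (Zf : nat -> weak_space X)] in
  ((exists f : R -> X, local_solution Z l h f) <-> (cond_a /\ cond_b)) /\
  (cond_a /\ cond_b ->
   forall f : R -> X, local_solution Z l h f ->
   forall s : R, 0 <= s < l ->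
     (fun n : nat => iter n.+1 (F (s / n.+1%:R)) h) @ \oo --> f s).
Proof.
move=> Z F u cond_a cond_b; have [w Zhw] := hh.
have derivF x y : operator_sum C D (x, y) ->
    of_real k h^-1 *: (F h x - x) @[h --> 0^'+] --> y.
  by rewrite genC genD; exact: trotter_deriv semigroupC semigroupD x y.
have dZ := dense_operator_sum hi.
(* Step sizes are left free: [t / n.+1] serves for the conditions, [s / n.+1] for the limit
   formula. *)
have solution_cvg f s (tau : nat -> R) : local_solution Z l h f -> 0 <= s < l ->
    tau @ \oo --> 0^'+ ->
    (fun n => iter (Num.truncn (s / tau n)) (F (tau n)) h) @ \oo --> f s.
  move=> solf sl tau0; apply/(cvg_csnP hp) => q e cq e0.
  have e20 : 0 < e / 2 by lra.
  near=> n; apply: (@le_lt_trans _ _ (e / 2)); last by lra.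
  near: n; exact: tau0 (pow_cvg_solution hp hii derivF dZ solf sl cq e20).
have uE s : u s = fun n => iter (Num.truncn (s * t / (t / n.+1%:R))) (F (t / n.+1%:R)) h.
  by apply/funext => n; rewrite /u invfM invrK mulrA mulfK ?gt_eqF// mulrC.
have scale s : 0 <= s < l / t -> 0 <= s * t < l.
  by rewrite ltr_pdivlMr// => /andP[s0 ->]; rewrite mulr_ge0// ltW.
have unscale s : 0 <= s < l -> 0 <= s / t < l / t.
  by rewrite ltr_pM2r ?invr_gt0// => /andP[s0 ->]; rewrite divr_ge0// ltW.
split; last first.
  move=> _ f solf s sl; have [s0 _] := andP sl.
  (* For [s = 0] the step sizes are not positive, and the claim follows from [F 0 = id] instead. *)
  move: s0; rewrite le_eqVlt => /predU1P[s0|s0].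
    have [_ F0 _] := hii.
    have -> : (fun n : nat => iter n.+1 (F (s / n.+1%:R)) h) = fun=> h.
      apply/funext => n; rewrite -s0 mul0r.
      by elim: n.+1 => // m; rewrite iterS => ->; exact: F0.
    by rewrite -s0 solf.1; exact: cvg_cst.
  have := solution_cvg f s _ solf sl (cvg_divn s0).
  rewrite (_ : (fun n => _) = fun n => iter n.+1 (F (s / n.+1%:R)) h)//.
  by apply/funext => n; rewrite invfM invrK mulrA divff ?gt_eqF// mul1r natrK.
split=> [[f solf]|[ca cb]].
  have ucvg s : 0 <= s < l / t -> u s @ \oo --> f (s * t).
    move=> /scale sl; rewrite uE.
    exact: solution_cvg solf sl (cvg_divn t_gt0).
  split=> s sl; first exact: cvg_subsequences (ucvg s sl).
  have [y [Zy _]] := solf.2 _ (scale s sl).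
  (* The limit itself serves as a constant approximating sequence. *)
  exists (fun=> f (s * t)), (fun=> y); split=> //.
    rewrite -(subrr (f (s * t))); apply: weakly_cvgB; apply: cvg_weakly_cvg.
      exact: ucvg.
    exact: cvg_cst.
  by apply: (@cvg_subsequences (weak_space X) (fun=> y) y); exact: cvg_cst.
(* This enumerates the rationals of [[0, l[], rescaled by [1 / t]; all other indices get the
   admissible time 0. *)
pose q i : R := let r := ratr (odflt 0 (unpickle i) : rat) in
  if 0 <= r < l then r / t else 0.
have ql i : 0 <= q i < l / t.
  rewrite /q; case: ifP => [/unscale//|_]; by rewrite lexx divr_gt0.
have [psi ipsi psi_cvg] := diagonal_subsequence (fun i => ca (q i) (ql i)).
pose tau n := t / (psi n).+1%:R.
have tau0 : tau @ \oo --> 0^'+ by exact: cvg_comp (incr_cvg ipsi) (cvg_divn t_gt0).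
have uU s : u (s / t) \o psi = fun n => iter (Num.truncn (s / tau n)) (F (tau n)) h.
  by apply/funext => n; rewrite uE /= divfK// gt_eqF.
have cauchy : forall s, 0 <= s < l -> tvs_cauchy_seq
    (fun n => iter (Num.truncn (s / tau n)) (F (tau n)) h).
  apply: (pow_cauchy hp hii derivF dZ tau0) => r rl.
  have [z b] := psi_cvg (pickle r); exists z.
  by rewrite -uU; move: b; rewrite /q pickleK /= rl.
have [f fP] : {f : R -> X | forall s, 0 <= s < l ->
    (fun n => iter (Num.truncn (s / tau n)) (F (tau n)) h) @ \oo --> f s}.
  have H (s : R) : exists z : X, 0 <= s < l ->
      (fun n => iter (Num.truncn (s / tau n)) (F (tau n)) h) @ \oo --> z.
    have [sl|nsl] := pselect (0 <= s < l); last by exists h.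
    by have [z hz] := complX _ (cauchy s sl); exists z.
  by have [f fP] := choice H; exists f.
exists f; apply: (limit_local_solution hp hii derivF dZ tau0 Zhw fP hausX l_gt0).
(* What remains is that [f s] lies in the domain: condition (b), thinned out along [psi], gives weak
   limits of both coordinates in the graph. *)
move=> s sl; have [g [Zg [Zgg ug Zgsub]]] := cb _ (unscale s sl).
have [chi ichi [y Zgy]] := Zgsub psi ipsi.
exists y; have [_ _ _ eC] := semigroupC; have [_ _ _ eD] := semigroupD.
apply: (closed_subspace_weakly_closed hp (a := g \o psi \o chi) (b := Zg \o psi \o chi)) => //.
- by rewrite genC genD; exact: operator_sum0 (generator0 hp eC) (generator0 hp eD).
- by rewrite genC genD; exact: operator_sumP (generatorP hp eC) (generatorP hp eD).
- by move=> n; exact: Zgg.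
have ichi' := incr_cvg ichi; have ipsi' := incr_cvg ipsi.
(* Here [g = u - (u - g)], where [u] converges along [psi] and the difference is weakly null. *)
have : weakly_cvg (fun n => u (s / t) (psi (chi n))
    - (u (s / t) (psi (chi n)) - g (psi (chi n)))) (f s - 0).
  apply: weakly_cvgB.
    apply: cvg_weakly_cvg.
    have := fP s sl; rewrite -uU => fs.
    exact: (cvg_comp chi (u (s / t) \o psi) ichi' fs).
  have ipc := cvg_comp _ _ ichi' ipsi'.
  exact: (@cvg_comp _ _ _ (psi \o chi)
    (fun n => u (s / t) n - g n : weak_space X) _ _ _ ipc ug).
rewrite subr0 (_ : (fun n => _) = g \o psi \o chi)//.
by apply/funext => n; rewrite subKr.
Unshelve. all: by end_near. Qed.
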